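(* Assume the setting, Assumption A and Assumption B in the context. Let $m_j$ be the means of the Gaussian projected filter (Algorithm GPF) and $m^s_j$ those of the Gaussian projected filter with surrogate (Algorithm GPF-s), both with the same initialization $m_0,C_0$, the same observations, and inflation $Q=aP$. Then, if the inflation parameter $a>0$ is sufficiently large, there is a constant $\mathsf C_3$ independent of $\varepsilon$ and $\delta$ such that $$\limsup_{j\to\infty}\mathbb E\|m_j-m^s_j\|\le\mathsf C_3(\varepsilon+\delta).$$
   Context: $\mathcal H$ separable Hilbert space, $\Psi:\mathcal H\to\mathcal H$, $u_0\in\mathcal H$, signal $u_j=\Psi(u_{j-1})$; $H:\mathcal H\to\mathbb R^k$ linear with $HH^*=I_k$, $P:=H^*H$; observations $y_j=Hu_j+\varepsilon\eta_j$, $\varepsilon>0$, $\eta_j$ independent with mean zero and covariance $R$. $V(u):=(\|u\|^2+\beta\|Pu\|^2)^{1/2}$. Assumption A: there exist $r>0,\beta\ge0,L>0,\alpha\in(0,1)$ such that $\mathcal B=\{\|u\|\le r\}$ is absorbing and forward invariant for $\Psi$, $V^2(\Psi(u)-\Psi(v))\le LV^2(u-v)$ and $V^2((I-P)(\Psi(u)-\Psi(v)))\le\alpha V^2(u-v)$ for $u,v\in\mathcal B$. Assumption B on $\Psi^s:\mathcal H\to\mathcal H$: there exist $\kappa,L_s,\delta>0$ with $\|\Psi^s(u)-\Psi(u)\|\le\kappa$, $\|(I-P)(\Psi^s(u)-\Psi(u))\|\le\delta$ for $u\in\mathcal B$, and $V^2(\Psi^s(u)-\Psi^s(v))\le L_sV^2(u-v)$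 for $u,v\in\mathcal B$. $P_{\mathcal B_V}$: orthogonal projection onto $\mathcal B$ in the $V$-norm; $\mathscr K(\Sigma):=\Sigma H^*(H\Sigma H^*+\varepsilon^2R)^{-1}$. Algorithm GPF (for a map $F\in\{\Psi,\Psi^s\}$; $F=\Psi$ gives $m_j,C_j$, $F=\Psi^s$ gives GPF-s with $m^s_j,C^s_j$): starting from $m_0,C_0$, for $j\ge1$, $\mu_j=\mathbb E_{u\sim\mathcal N(m_{j-1},C_{j-1})}[F(P_{\mathcal B_V}u)]$, $\Sigma_j=\mathbb E_{u\sim\mathcal N(m_{j-1},C_{j-1})}[(F(P_{\mathcal B_V}u)-\mu_j)\otimes(F(P_{\mathcal B_V}u)-\mu_j)]$, $m_j=\mu_j+\mathscr K(\Sigma_j+Q)(y_j-H\mu_j)$, $C_j=(I-\mathscr K(\Sigma_j+Q)H)(\Sigma_j+Q)$ (all quantities carrying superscript $s$ when $F=\Psi^s$). Expectation over the observation noise. *)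

(* Defs.v *)
From HB Require Import structures.
From mathcomp Require Import all_boot all_order all_algebra.
From mathcomp Require Import all_classical all_reals all_analysis.
Set Implicit Arguments. Unset Strict Implicit. Unset Printing Implicit Defensive.
Import Order.TTheory GRing.Theory Num.Theory.
Import numFieldNormedType.Exports.
Local Open Scope classical_set_scope.
Local Open Scope ring_scope.

Definition hilbert_ip {R : realType} {H : completeNormedModType R}
  (ip : H -> H -> R) : Prop :=
  [/\ (forall x y, ip x y = ip y x),
      (forall (c : R) x y z, ip (c *: x + y) z = c * ip x z + ip y z),
      (forall x, ip x x = `|x| ^+ 2)
    & exists s : nat -> H, forall x (e : R), 0 < e -> exists n, `|x - s n| < e].

Definition obs_operator {R : realType} {H : completeNormedModType R} (k : nat)
  (ip : H -> H -> R) (Hop : H -> 'cV[R]_k) (Hs : 'cV[R]_k -> H) : Prop :=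
  [/\ (forall (c : R) x y, Hop (c *: x + y) = c *: Hop x + Hop y),
      (forall (y : 'cV[R]_k) u, ip (Hs y) u = (y^T *m Hop u) 0 0)
    & (forall y, Hop (Hs y) = y)].

Section Defs.
Context {R : realType} {H : completeNormedModType R} {k : nat}.
Variables (ip : H -> H -> R) (Hop : H -> 'cV[R]_k) (Hs : 'cV[R]_k -> H).

Definition Pproj (u : H) : H := Hs (Hop u).

Definition V2 (beta : R) (u : H) : R := `|u| ^+ 2 + beta * `|Pproj u| ^+ 2.
Definition Vnorm (beta : R) (u : H) : R := Num.sqrt (V2 beta u).

Definition ballB (r : R) : set H := [set u | `|u| <= r].

Definition assumptionA (Psi : H -> H) (r beta L alpha : R) : Prop :=
  [/\ 0 < r, 0 <= beta, 0 < L, 0 < alpha /\ alpha < 1 &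
    [/\
      (forall u0, exists J, forall j, (J <= j)%N -> ballB r (iter j Psi u0)),
      (forall u, ballB r u -> ballB r (Psi u)),
      (forall u v, ballB r u -> ballB r v ->
         V2 beta (Psi u - Psi v) <= L * V2 beta (u - v))
    & (forall u v, ballB r u -> ballB r v ->
         V2 beta ((Psi u - Psi v) - Pproj (Psi u - Psi v)) <= alpha * V2 beta (u - v))]].

Definition assumptionB (Psi Psis : H -> H) (r beta kappa Ls delta : R) : Prop :=
  [/\ 0 < kappa, 0 < Ls, 0 < delta &
    [/\ (forall u, ballB r u -> `|Psis u - Psi u| <= kappa),
      (forall u, ballB r u ->
         `|(Psis u - Psi u) - Pproj (Psis u - Psi u)| <= delta)
    & (forall u v, ballB r u -> ballB r v ->
         V2 beta (Psis u - Psis v) <= Ls * V2 beta (u - v))]].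

Definition is_Vprojection (r beta : R) (PB : H -> H) : Prop :=
  forall u, ballB r (PB u) /\
    forall v, ballB r v -> Vnorm beta (u - PB u) <= Vnorm beta (u - v).

(* u is a Gaussian random element of H with law N(m, C): every
   t |-> <h, u t> is measurable and the characteristic functional is
   E exp(i<h,u>) = exp(i<h,m> - <Ch,h>/2) (real and imaginary parts). *)
Definition gaussian_elt {d} {T : measurableType d} (Pr : probability T R)
  (u : T -> H) (m : H) (C : H -> H) : Prop :=
  forall h : H,
  [/\ measurable_fun setT (fun t => ip h (u t)),
      (\int[Pr]_t (cos (ip h (u t)))%:E =
         (cos (ip h m) * expR (- (ip (C h) h / 2)))%:E)%E
    & (\int[Pr]_t (sin (ip h (u t)))%:E =
         (sin (ip h m) * expR (- (ip (C h) h / 2)))%:E)%E].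

(* mu = E_{u ~ N(m,C)} [F (P_B u)] and Sigma its covariance operator,
   both characterised weakly (Pettis / via the inner product). *)
Definition push_mean_cov (F PB : H -> H) (m : H) (C : H -> H)
  (mu : H) (Sigma : H -> H) : Prop :=
  exists (d : measure_display) (T : measurableType d) (Pr : probability T R)
         (u : T -> H),
  [/\ gaussian_elt Pr u m C,
      (forall h, ((ip mu h)%:E = \int[Pr]_t (ip (F (PB (u t))) h)%:E)%E)
    & (forall h g, ((ip (Sigma h) g)%:E =
         \int[Pr]_t (ip (F (PB (u t)) - mu) h * ip (F (PB (u t)) - mu) g)%:E)%E)].

(* Analysis step with inflated covariance S = Sigma + Q, Q = a P,
   gain K(S) = S H^* (H S H^* + eps^2 Rn)^{-1}. *)
Definition innov_mx (Rn : 'M[R]_k) (eps : R) (S : H -> H) : 'M[R]_k :=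
  \matrix_(i, l) ((Hop (S (Hs (delta_mx l 0)))) i 0 + eps ^+ 2 * Rn i l).

Definition gain (Rn : 'M[R]_k) (eps : R) (S : H -> H) (y : 'cV[R]_k) : H :=
  S (Hs (invmx (innov_mx Rn eps S) *m y)).

Definition inflate (a : R) (Sigma : H -> H) : H -> H :=
  fun u => Sigma u + a *: Pproj u.

(* Algorithm GPF for the map F (F = Psi: GPF; F = Psis: GPF-s), driven by
   the observation sequence y (a function of the noise outcome). *)
Definition GPF (F PB : H -> H) (Rn : 'M[R]_k) (eps a : R) (m0 : H) (C0 : H -> H)
  {Omega : Type} (y : nat -> Omega -> 'cV[R]_k)
  (m : nat -> Omega -> H) (C : nat -> Omega -> H -> H) : Prop :=
  [/\ (forall w, m 0%N w = m0), (forall w, C 0%N w = C0)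
    & forall (j : nat) (w : Omega), exists (mu : H) (Sigma : H -> H),
      let S := inflate a Sigma in
      [/\ push_mean_cov F PB (m j w) (C j w) mu Sigma,
          m j.+1 w = mu + gain Rn eps S (y j.+1 w - Hop mu)
        & C j.+1 w = fun u => S u - gain Rn eps S (Hop (S u))]].

End Defs.

(* eta_j: independent (mutually, as a sequence) random vectors in R^k with
   mean zero and covariance Rn. Independence is stated on the generating
   pi-system of product-of-coordinate events. *)
Definition noise_seq {R : realType} {d} {Omega : measurableType d} (k : nat)
  (Pr : probability Omega R) (eta : nat -> Omega -> 'cV[R]_k) (Rn : 'M[R]_k) : Prop :=
  [/\ (forall j i, measurable_fun setT (fun w => eta j w i 0)),
      (forall j i, Pr.-integrable setT (fun w => (eta j w i 0)%:E)),
      (forall j i, (\int[Pr]_w (eta j w i 0)%:E = 0)%E) &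
    [/\
      (forall j i l, Pr.-integrable setT (fun w => (eta j w i 0 * eta j w l 0)%:E)),
      (forall j i l, (\int[Pr]_w (eta j w i 0 * eta j w l 0)%:E = (Rn i l)%:E)%E)
    & (forall (n : nat) (B : nat -> 'I_k -> set R),
         (forall j i, measurable (B j i)) ->
         Pr (\bigcap_(j < n) \bigcap_(i : 'I_k) [set w | B j i (eta j w i 0)]) =
         (\prod_(j < n) Pr (\bigcap_(i : 'I_k) [set w | B j i (eta j w i ord0)]))%E)]].

(* Main.v *)
(* Split the state along P and I - P.  The dynamics contract V in expectation
   in the range of I - P up to the model error delta, and the analysis step only
   decreases the covariance there, while in the range of P the posterior
   covariance is at most eps^2 R.  Hence the V-trace of C_j satisfies an affine
   recursion and is eventually O((eps + delta)^2).  The gain differs from H^* by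
   eps^2 H^* R A^-1 and by (I - P) Sigma H^* A^-1, where A is the innovation
   matrix and A >= a; Cauchy-Schwarz bounds the latter by the square root of the
   trace of (I - P) Sigma (I - P), so this cross term is eventually O(eps + delta)
   for every a > 0 and the threshold on a can be taken to be 0.  The V-error of
   the mean plus a multiple of the square root of the trace bound then contracts
   up to a source delta + eps (1 + |eta_j|^2), and both filters are compared with
   the signal.

   Traces are taken in an orthonormal frame of ker H completed by H^* delta_i.
   Only the inequality E V^2(u - v) <= V^2(m - v) + trace C is needed for
   u ~ N(m, C); it follows from the characteristic function by Fatou applied to
   2 (1 - cos(s X)) / s^2 as s -> 0. *)
Require Import Defs.
From HB Require Import structures.
From mathcomp Require Import all_boot all_order all_algebra.
From mathcomp Require Import all_classical all_reals all_analysis.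
From mathcomp Require Import measurable_realfun.
From mathcomp Require Import ring lra.
Import Order.TTheory GRing.Theory Num.Theory.
Import numFieldNormedType.Exports.
Local Open Scope classical_set_scope.
Local Open Scope ring_scope.
Set Implicit Arguments.
Unset Strict Implicit.
Unset Printing Implicit Defensive.

(** * Inner products and Gram-Schmidt *)

Section InnerProduct.
Context {R : realType} {H : completeNormedModType R} (ip : H -> H -> R).
Hypothesis ipH : hilbert_ip ip.

Lemma ipC x y : ip x y = ip y x.
Proof. by case: ipH. Qed.

Lemma ip_lin (c : R) x y z : ip (c *: x + y) z = c * ip x z + ip y z.
Proof. by case: ipH. Qed.

Lemma ipxx x : ip x x = `|x| ^+ 2.
Proof. by case: ipH. Qed.

Lemma ipDl x y z : ip (x + y) z = ip x z + ip y z.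
Proof. by have := ip_lin 1 x y z; rewrite scale1r mul1r. Qed.

Lemma ip0l z : ip 0 z = 0.
Proof. by have := ipDl 0 0 z; rewrite addr0; lra. Qed.

Lemma ipZl (c : R) x z : ip (c *: x) z = c * ip x z.
Proof. by have := ip_lin c x 0 z; rewrite addr0 ip0l addr0. Qed.

Lemma ipNl x z : ip (- x) z = - ip x z.
Proof. by rewrite -scaleN1r ipZl mulN1r. Qed.

Lemma ipBl x y z : ip (x - y) z = ip x z - ip y z.
Proof. by rewrite ipDl ipNl. Qed.

Lemma ip0r z : ip z 0 = 0.
Proof. by rewrite ipC ip0l. Qed.

Lemma ipDr x y z : ip z (x + y) = ip z x + ip z y.
Proof. by rewrite ipC ipDl !(ipC z). Qed.

Lemma ipZr (c : R) x z : ip z (c *: x) = c * ip z x.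
Proof. by rewrite ipC ipZl (ipC z). Qed.

Lemma ipNr x z : ip z (- x) = - ip z x.
Proof. by rewrite ipC ipNl (ipC z). Qed.

Lemma ipBr x y z : ip z (x - y) = ip z x - ip z y.
Proof. by rewrite ipDr ipNr. Qed.

Lemma ip_suml n (F : 'I_n -> H) z : ip (\sum_(i < n) F i) z = \sum_(i < n) ip (F i) z.
Proof.
elim: n F => [|n IH] F; first by rewrite !big_ord0 ip0l.
by rewrite !big_ord_recr /= ipDl IH.
Qed.

Lemma ip_ext x y : (forall z, ip x z = ip y z) -> x = y.
Proof.
move=> exy; apply/eqP; rewrite -subr_eq0 -normr_eq0 -sqrf_eq0 -ipxx.
by rewrite ipBl exy subrr.
Qed.

(** For [a > 0] the quadratic is tested at its vertex. For [a <= 0] nonnegativity forces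
    [a = b = 0], a case that matters because covariance forms can be degenerate. *)
Lemma discriminant_le (a b c : R) :
  (forall t, 0 <= t ^+ 2 * a + 2 * t * b + c) -> b ^+ 2 <= a * c.
Proof.
move=> h; have c0 : 0 <= c by have := h 0; rewrite expr0n/= !(mul0r,mulr0) !add0r.
have [a0|a0] := ltP 0 a.
  have := h (- b / a); rewrite -(ler_pM2l a0) mulr0 => h0.
  have e : a * ((- b / a) ^+ 2 * a + 2 * (- b / a) * b + c) = a * c - b ^+ 2.
    by field; rewrite gt_eqF.
  by rewrite e in h0; lra.
have [b0|b0] := eqVneq b 0.
  suff -> : a = 0 by rewrite b0 expr0n/= mul0r.
  have [//|an0] := eqVneq a 0.
  have an : a < 0 by rewrite lt_neqAle an0.
  have u : 0 < (- a)^-1 by rewrite invr_gt0 oppr_gt0.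
  (* As [1 <= t] and [a < 0], [t ^+ 2 * a <= t * a], which brings the quadratic down to at most
     [a - 1]. *)
  have [t [ta t1]] : exists t, t * a = - (c + 1) + a /\ 1 <= t.
    exists ((c + 1) / - a + 1); split; first by field; rewrite lt_eqF.
    by rewrite lerDr mulr_ge0// ?addr_ge0// ltW.
  have : t ^+ 2 * a <= t * a.
    have : (t - 1) * (t * a) <= 0 by rewrite mulr_ge0_le0 ?ta; lra.
    by rewrite expr2; lra.
  by move: (h t); rewrite b0 ta; lra.
have := h (- (c + 1) / (2 * b)).
have -> : 2 * (- (c + 1) / (2 * b)) * b = - (c + 1) by field.
have : (- (c + 1) / (2 * b)) ^+ 2 * a <= 0 by rewrite mulr_ge0_le0// sqr_ge0.
lra.
Qed.

(** Nonnegativity along the line [t *: x + y] is a discriminant condition. Semidefinite forms are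
    covered so as to include [ip (Sigma x) y] besides [ip]. *)
Lemma psd_form_CS (B : H -> H -> R) :
  (forall x y, B x y = B y x) ->
  (forall (c : R) x y z, B (c *: x + y) z = c * B x z + B y z) ->
  (forall x, 0 <= B x x) ->
  forall x y, B x y ^+ 2 <= B x x * B y y.
Proof.
move=> BC Bl B0 x y; apply: discriminant_le => t.
have := B0 (t *: x + y); rewrite Bl !(BC _ (t *: x + y)) !Bl (BC y x).
by congr (0 <= _); ring.
Qed.

Lemma ip_sqr_le x y : ip x y ^+ 2 <= `|x| ^+ 2 * `|y| ^+ 2.
Proof.
rewrite -!ipxx; apply: psd_form_CS; [exact: ipC|exact: ip_lin|].
by move=> z; rewrite ipxx sqr_ge0.
Qed.

Lemma ip_norm_le x y : `|ip x y| <= `|x| * `|y|.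
Proof.
rewrite -ler_sqr ?nnegrE ?mulr_ge0//.
by rewrite real_normK ?num_real// exprMn ip_sqr_le.
Qed.

Lemma sqr_normD x y : `|x + y| ^+ 2 = `|x| ^+ 2 + 2 * ip x y + `|y| ^+ 2.
Proof. by rewrite -!ipxx ipDl !ipDr (ipC y x); ring. Qed.

Lemma sqr_normB x y : `|x - y| ^+ 2 = `|x| ^+ 2 - 2 * ip x y + `|y| ^+ 2.
Proof. by rewrite sqr_normD normrN ipNr; ring. Qed.

(** * Gram-Schmidt and Parseval for a dense sequence *)

Section GramSchmidt.
Variable s : nat -> H.

Definition gs_step (l : seq H) (v : H) : H :=
  let w := v - \sum_(x <- l) ip v x *: x in `|w|^-1 *: w.

Fixpoint gs_seq (n : nat) : seq H :=
  if n is p.+1 then rcons (gs_seq p) (gs_step (gs_seq p) (s p)) else [::].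

Definition gs (n : nat) : H := gs_step (gs_seq n) (s n).

Definition gs_proj (n : nat) (x : H) : H := \sum_(i < n) ip x (gs i) *: gs i.

Lemma gs_seqE n (F : H -> H) : \sum_(x <- gs_seq n) F x = \sum_(i < n) F (gs i).
Proof.
elim: n => [|n IH]; first by rewrite big_nil big_ord0.
by rewrite /= big_rcons big_ord_recr /= IH.
Qed.

Lemma gsE n : let w := s n - gs_proj n (s n) in gs n = `|w|^-1 *: w.
Proof. by rewrite /= {1}/gs /gs_step gs_seqE. Qed.

Lemma gs_sqr_norm n : ip (gs n) (gs n) = 0 /\ gs n = 0 \/ ip (gs n) (gs n) = 1.
Proof.
rewrite gsE; set w := (s n - _).
have [->|w0] := eqVneq w 0; first by left; rewrite scaler0 ip0l.
right; rewrite ipZl ipZr ipxx; field.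
by rewrite normr_eq0.
Qed.

Lemma ip_gs_unit n x : ip x (gs n) * ip (gs n) (gs n) = ip x (gs n).
Proof.
by case: (gs_sqr_norm n) => [[-> ->]| ->]; rewrite ?ip0r ?mulr1 ?mulr0.
Qed.

Lemma gs_orth n i j : (i < n)%N -> (j < n)%N -> i != j -> ip (gs i) (gs j) = 0.
Proof.
elim: n i j => [//|n IH].
have main j : (j < n)%N -> ip (gs n) (gs j) = 0.
  move=> jn; rewrite gsE ipZl ipBl ip_suml (bigD1 (Ordinal jn)) //= big1 => [|i ij].
    by rewrite addr0 ipZl ip_gs_unit subrr mulr0.
  by rewrite ipZl IH ?mulr0.
move=> i j; rewrite ltnS leq_eqVlt => /orP[/eqP ->|ilt];
  rewrite ltnS leq_eqVlt => /orP[/eqP ->|jlt] ij.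
- by rewrite eqxx in ij.
- exact: main.
- by rewrite ipC main.
- exact: IH.
Qed.

Lemma ip_gs_comb n (c : nat -> R) (i : nat) : (i < n)%N ->
  ip (gs i) (\sum_(j < n) c j *: gs j) = c i * ip (gs i) (gs i).
Proof.
move=> ilt; rewrite ipC ip_suml (bigD1 (Ordinal ilt)) //= big1 ?addr0 ?ipZl// => j ji.
by rewrite ipZl (@gs_orth n) ?mulr0.
Qed.

(** The residual of the projection is orthogonal to the span, so Pythagoras makes [gs_proj n x] the
    best approximation in it. *)
Lemma gs_residual n x (c : nat -> R) :
  `|x - \sum_(i < n) c i *: gs i| ^+ 2 =
  `|x - gs_proj n x| ^+ 2 + `|gs_proj n x - \sum_(i < n) c i *: gs i| ^+ 2.
Proof.
have -> : x - \sum_(i < n) c i *: gs i =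
  (x - gs_proj n x) + (gs_proj n x - \sum_(i < n) c i *: gs i).
  by rewrite addrA subrK.
rewrite [LHS]sqr_normD; suff -> : ip (x - gs_proj n x)
  (gs_proj n x - \sum_(i < n) c i *: gs i) = 0 by rewrite mulr0 addr0.
rewrite -sumrB ipC ip_suml big1// => i _.
rewrite -scalerBl ipZl ipBr (ip_gs_comb (fun j => ip x (gs j)))// ip_gs_unit.
by rewrite ipC subrr mulr0.
Qed.

Lemma gs_bessel_eq n x :
  `|x - gs_proj n x| ^+ 2 = `|x| ^+ 2 - \sum_(i < n) ip x (gs i) ^+ 2.
Proof.
rewrite sqr_normB -(ipxx (gs_proj n x)).
have e y : ip (gs_proj n x) y = \sum_(i < n) ip x (gs i) * ip (gs i) y.
  by rewrite ip_suml; apply: eq_bigr => i _; rewrite ipZl.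
rewrite ipC !e; have -> : \sum_(i < n) ip x (gs i) * ip (gs i) (gs_proj n x) =
  \sum_(i < n) ip x (gs i) ^+ 2.
  apply: eq_bigr => i _; rewrite (ip_gs_comb (fun j => ip x (gs j)))//.
  by rewrite ip_gs_unit expr2.
have -> : \sum_(i < n) ip x (gs i) * ip (gs i) x = \sum_(i < n) ip x (gs i) ^+ 2.
  by apply: eq_bigr => i _; rewrite (ipC (gs i)) expr2.
ring.
Qed.

Lemma gs_bessel n x : \sum_(i < n) ip x (gs i) ^+ 2 <= `|x| ^+ 2.
Proof. by rewrite -subr_ge0 -gs_bessel_eq sqr_ge0. Qed.

Lemma gs_span n : exists c : nat -> R, s n = \sum_(i < n.+1) c i *: gs i.
Proof.
pose w := s n - gs_proj n (s n).
exists (fun i => if (i < n)%N then ip (s n) (gs i) else `|w|).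
rewrite big_ord_recr /= ltnn (eq_bigr (fun i : 'I_n => ip (s n) (gs i) *: gs i)).
  rewrite gsE -/w scalerA; have [w0|w0] := eqVneq w 0.
    by rewrite w0 normr0 mul0r scale0r addr0; apply/eqP; rewrite -subr_eq0; apply/eqP.
  by rewrite divff ?normr_eq0// scale1r /w addrC subrK.
by move=> i _; rewrite ltn_ord.
Qed.

(** Some [s n] lies within [Num.sqrt e] of [x] and in the span of the first [n.+1] vectors. Best
    approximation transfers this to the projection, and the deficit in Bessel's inequality is the
    squared distance. *)
Lemma gs_parseval x : (forall e, 0 < e -> exists n, `|x - s n| < e) ->
  (fun n => \sum_(i < n) ip x (gs i) ^+ 2) @ \oo --> `|x| ^+ 2.
Proof.
move=> xs; apply/cvgrPdist_lt => e e0.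
have [n xn] : exists n, `|x - s n| < Num.sqrt e by apply: xs; rewrite sqrtr_gt0.
exists n.+1 => //= m nm.
rewrite ger0_norm ?subr_ge0 ?gs_bessel//.
have mono : \sum_(i < n.+1) ip x (gs i) ^+ 2 <= \sum_(i < m) ip x (gs i) ^+ 2.
  rewrite -(subnK nm) addnC big_split_ord /= lerDl.
  by apply: sumr_ge0 => i _; exact: sqr_ge0.
apply: (@le_lt_trans _ _ (`|x - gs_proj n.+1 x| ^+ 2)).
  by rewrite gs_bessel_eq; lra.
have [c sc] := gs_span n.
apply: (@le_lt_trans _ _ (`|x - s n| ^+ 2)).
  by rewrite [in leRHS]sc gs_residual lerDl sqr_ge0.
rewrite -[e]sqr_sqrtr ?ltW// ltr_sqr// ?nnegrE ?sqrtr_ge0//.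
Qed.

(** Used with [D] the kernel of [Hop], to keep the orthonormalised vectors inside it. *)
Lemma gs_closed (D : set H) : D 0 ->
  (forall (c : R) x y, D x -> D y -> D (c *: x + y)) ->
  (forall n, D (s n)) -> forall n, D (gs n).
Proof.
move=> D0 lin Ds n.
have Dsc (c : R) x : D x -> D (c *: x).
  by move=> Dx; rewrite -[c *: x]addr0; exact: lin.
elim/ltn_ind: n => n IH; rewrite gsE; apply/Dsc; rewrite addrC -scaleN1r.
apply/lin => //.
rewrite /gs_proj; apply: (big_ind D) => // [x y Dx Dy|i _]; last by apply/Dsc/IH.
by rewrite -[x]scale1r; exact: lin.
Qed.

End GramSchmidt.
End InnerProduct.

(** * Integrals of real functions *)

Section RealIntegrals.
Context {R : realType}.

Lemma eq_cvgn (u v : nat -> R) (l : R) :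
  (forall n, u n = v n) -> u @ \oo --> l -> v @ \oo --> l.
Proof. by move=> /funext ->. Qed.

Lemma diff_quotient_cvg (f : R -> R) (l : R) (h : nat -> R) :
  is_derive (0 : R) (1 : R) f l -> h @ \oo --> 0 -> (forall n, h n != 0) ->
  (fun n => (f (h n) - f 0) / h n) @ \oo --> l.
Proof.
move=> [df dl] h0 hn0.
have q : (fun x : R => x^-1 * (f x - f 0)) @ 0^' --> l.
  rewrite -dl; move: df; rewrite /derivable /derive.
  have -> : (fun h0 : R => h0^-1 *: ((f \o shift 0) (h0 *: 1) - f 0)) =
    (fun h0 => h0^-1 * (f h0 - f 0)).
    by apply/funext => y /=; rewrite addr0 [_ *: 1]mulr1.
  by [].
have [+ _] := cvgr_dnbhsP (fun x : R => x^-1 * (f x - f 0)) 0 l.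
by move=> /(_ q h (conj hn0 h0)); apply: eq_cvgn => n; rewrite mulrC.
Qed.

Lemma harmonic_neq0 n : harmonic n != 0 :> R.
Proof. by rewrite gt_eqF// harmonic_gt0. Qed.

(** By the half-angle formula the expression is the square of a difference quotient of [sin (y * x)]
    at 0, with step [harmonic n / 2]. *)
Lemma sqr_cos_quotient_cvg (x : R) :
  (fun n => 2 * (1 - cos (harmonic n * x)) / harmonic n ^+ 2) @ \oo --> x ^+ 2.
Proof.
have D : is_derive (0 : R) (1 : R) (fun y : R => sin (y * x)) x.
  apply: is_derive_eq; rewrite mul0r cos0 /GRing.scale /= .
  by rewrite mul1r ?mulr1 ?mulr0 ?add0r ?addr0.
have h0 : (fun n => harmonic n / 2 : R) @ \oo --> 0.
  rewrite -[X in _ --> X](mul0r (2^-1 : R)); apply: cvgMl; exact: cvg_harmonic.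
have hn0 n : harmonic n / 2 != 0 :> R by rewrite mulf_neq0// harmonic_neq0.
have q := diff_quotient_cvg D h0 hn0; 
pose Q n := (sin (harmonic n / 2 * x) - sin (0 * x)) / (harmonic n / 2) : R.
apply: (@eq_cvgn (fun n => Q n * Q n)); last by rewrite expr2; exact: cvgM.
rewrite /Q => n.
rewrite mul0r sin0 subr0.
have -> : cos (harmonic n * x) = 1 - 2 * sin (harmonic n / 2 * x) ^+ 2.
  rewrite -[harmonic n * x](_ : (harmonic n / 2 * x) *+ 2 = _).
    by rewrite cos_mulr2n cos2sin2; ring.
  by rewrite mulr2n; field.
by move: (harmonic n) (harmonic_neq0 n) => h hneq0; field.
Qed.

(** The same second difference quotient for a Gaussian characteristic function. It splits into the
    cosine quotient and a quotient of the exponential with step [harmonic n ^+ 2], whose limit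
    contributes [v]. *)
Lemma gauss_quotient_cvg (m v : R) :
  (fun n => 2 * (1 - cos (harmonic n * m) * expR (- (harmonic n ^+ 2 * v / 2)))
     / harmonic n ^+ 2) @ \oo --> m ^+ 2 + v.
Proof.
have D : is_derive (0 : R) (1 : R) (fun y : R => expR (y * (- v / 2))) (- v / 2).
  apply: is_derive_eq; rewrite mul0r expR0 /GRing.scale /=.
  by rewrite ?mul1r ?mulr1 ?mulr0 ?add0r ?addr0.
have h0 : (fun n => harmonic n * harmonic n : R) @ \oo --> 0.
  rewrite -[X in _ --> X](mul0r (0 : R)); apply: cvgM; exact: cvg_harmonic.
have q := diff_quotient_cvg D h0 (fun n => mulf_neq0 (harmonic_neq0 n) (harmonic_neq0 n)).
have c1 : (fun n => cos (harmonic n * m)) @ \oo --> (1 : R).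
  have hm : (fun n => harmonic n * m) @ \oo --> (0 : R).
    have e : 0 = 0 * m by rewrite mul0r.
    rewrite [X in _ --> X]e; apply: cvgMl; exact: cvg_harmonic.
  rewrite -(@cos0 R); exact: (cvg_comp _ _ hm (@continuous_cos R 0)).
have -> : m ^+ 2 + v = m ^+ 2 + (-2 * 1) * (- v / 2) by field.
pose Q n := (expR (harmonic n * harmonic n * (- v / 2)) - expR (0 * (- v / 2))) /
  (harmonic n * harmonic n) : R.
apply: (@eq_cvgn (fun n => 2 * (1 - cos (harmonic n * m)) / harmonic n ^+ 2 +
  -2 * cos (harmonic n * m) * Q n)); last first.
  by apply: cvgD; [exact: sqr_cos_quotient_cvg|apply: cvgM => //; exact: cvgMr].
move=> n; rewrite /Q mul0r expR0.
have -> : harmonic n * harmonic n * (- v / 2) = - (harmonic n ^+ 2 * v / 2) by field.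
by move: (harmonic n) (harmonic_neq0 n) => h hneq0; field.
Qed.

Context {d : measure_display} {T : measurableType d}.

(** Monotonicity is read off the supremum over simple functions, so that it applies to the filter
    error, about whose measurability nothing is known. *)
Lemma le_integral_ge0 (mu : {measure set T -> \bar R}) (f g : T -> \bar R) :
  (forall t, 0 <= f t)%E -> (forall t, f t <= g t)%E ->
  (\int[mu]_t f t <= \int[mu]_t g t)%E.
Proof.
move=> f0 fg; have g0 t : (0 <= g t)%E by exact: le_trans (fg t).
rewrite !ge0_integralTE//; apply: ereal_sup_le.
by move=> _ [h hf <-]; exists h => // t; apply: le_trans (fg t); exact: hf.
Qed.

Lemma cvgn_EFin (u : nat -> R) (l : R) : u @ \oo --> l -> (fun n => (u n)%:E) @ \oo --> l%:E.
Proof. by move=> ul; apply: cvg_EFin => //; exact: nearW. Qed.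

(** Convergence of [g] and [K] turns both lower limits in Fatou's lemma into limits. It serves for
    the cosine quotients and for the truncation of frame sums. *)
Lemma fatou_le (mu : {measure set T -> \bar R}) (g : nat -> T -> R) (G : T -> R)
    (K : nat -> R) (K0 : R) :
  (forall n, measurable_fun setT (g n)) -> (forall n t, 0 <= g n t) ->
  (forall t, (fun n => g n t) @ \oo --> G t) ->
  (forall n, (\int[mu]_t (g n t)%:E <= (K n)%:E)%E) -> K @ \oo --> K0 ->
  (\int[mu]_t (G t)%:E <= K0%:E)%E.
Proof.
move=> mg g0 gG gK KK0.
have -> : (\int[mu]_t (G t)%:E = \int[mu]_t limn_einf (fun n => (g n t)%:E))%E.
  apply: eq_integral => t _; apply/esym.
  by have [-> _] := cvg_limn_einf_sup (cvgn_EFin (gG t)).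
apply: (le_trans (fatou mu measurableT (f := fun n t => (g n t)%:E) _ _)).
- by move=> n; apply/measurable_EFinP.
- by move=> n t _; rewrite lee_fin.
have <- : limn_einf (EFin \o K) = K0%:E.
  by have [-> _] := cvg_limn_einf_sup (cvgn_EFin KK0).
rewrite !limn_einf_lim; apply: lee_lim; [exact: is_cvg_einfs|exact: is_cvg_einfs|].
apply: nearW => n; apply: le_ereal_inf_tmp => _ [m /= nm <-].
by apply: (le_trans (ereal_inf_lbound _) (gK m)); exists m.
Qed.

Lemma EFin_Rintegral (mu : {measure set T -> \bar R}) (f : T -> R) :
  mu.-integrable setT (EFin \o f) ->
  (\int[mu]_t (f t)%:E)%E = (\int[mu]_t f t)%:E.
Proof. by move=> fi; rewrite /Rintegral fineK//; exact: integrable_fin_num. Qed.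

Variable Pr : probability T R.

Lemma bounded_integrable (f : T -> R) (K : R) :
  measurable_fun setT f -> (forall t, `|f t| <= K) -> Pr.-integrable setT (EFin \o f).
Proof.
move=> mf fK; apply: measurable_bounded_integrable => //.
  by apply: (@le_lt_trans _ _ 1%E); [exact: probability_le1|exact: ltry].
exists K; split; first exact: num_real.
by move=> M KM t _ /=; apply: (le_trans (fK t)); exact: ltW.
Qed.

Lemma Rintegral_cst_prob (c : R) : \int[Pr]_t c = c.
Proof. by rewrite Rintegral_cst// [X in fine X](_ : _ = 1%E) ?mulr1//; exact: probability_setT. Qed.

Lemma integrable_cst_prob (c : R) : Pr.-integrable setT (EFin \o (fun=> c)).
Proof. exact: (@bounded_integrable _ `|c|). Qed.

Lemma Rintegral_le_cst (f : T -> R) (K : R) :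
  Pr.-integrable setT (EFin \o f) -> (forall t, f t <= K) -> \int[Pr]_t f t <= K.
Proof.
move=> fi fK; rewrite -[leRHS]Rintegral_cst_prob; apply: le_Rintegral => //.
exact: integrable_cst_prob.
Qed.

End RealIntegrals.

(** * Observation operator and V-norm *)

Section Observation.
Context {R : realType} {H : completeNormedModType R} (ip : H -> H -> R).
Context (k : nat) (Hop : H -> 'cV[R]_k) (Hs : 'cV[R]_k -> H).
Hypothesis ipH : hilbert_ip ip.
Hypothesis obsH : obs_operator ip Hop Hs.

Local Notation P := (Pproj Hop Hs).

Lemma Hop_lin (c : R) x y : Hop (c *: x + y) = c *: Hop x + Hop y.
Proof. by case: obsH. Qed.

Lemma HopD x y : Hop (x + y) = Hop x + Hop y.
Proof. by have := Hop_lin 1 x y; rewrite !scale1r. Qed.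

Lemma Hop0 : Hop 0 = 0.
Proof. by apply: (addrI (Hop 0)); rewrite -HopD !addr0. Qed.

Lemma HopZ (c : R) x : Hop (c *: x) = c *: Hop x.
Proof. by have := Hop_lin c x 0; rewrite Hop0 !addr0. Qed.

Lemma HopB x y : Hop (x - y) = Hop x - Hop y.
Proof. by rewrite HopD -scaleN1r HopZ scaleN1r. Qed.

Lemma HopK y : Hop (Hs y) = y.
Proof. by case: obsH. Qed.

Lemma ip_Hs y u : ip (Hs y) u = (y^T *m Hop u) 0 0.
Proof. by case: obsH. Qed.

(** Linearity of the adjoint comes from testing the adjoint identity against every [u]. *)
Lemma Hs_lin (c : R) y z : Hs (c *: y + z) = c *: Hs y + Hs z.
Proof.
apply: (ip_ext ipH) => u.
by rewrite (ip_lin ipH) !ip_Hs linearP /= mulmxDl -scalemxAl !mxE.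
Qed.

Lemma HsD y z : Hs (y + z) = Hs y + Hs z.
Proof. by have := Hs_lin 1 y z; rewrite !scale1r. Qed.

Lemma Hs0 : Hs 0 = 0.
Proof. by apply: (addrI (Hs 0)); rewrite -HsD !addr0. Qed.

Lemma HsZ (c : R) y : Hs (c *: y) = c *: Hs y.
Proof. by have := Hs_lin c y 0; rewrite Hs0 !addr0. Qed.

Lemma HsB y z : Hs (y - z) = Hs y - Hs z.
Proof. by rewrite HsD -scaleN1r HsZ scaleN1r. Qed.

Lemma P_lin (c : R) x y : P (c *: x + y) = c *: P x + P y.
Proof. by rewrite /Pproj Hop_lin Hs_lin. Qed.

Lemma PprojB x y : P (x - y) = P x - P y.
Proof. by rewrite /Pproj HopB HsB. Qed.

Lemma Hop_P x : Hop (P x) = Hop x.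
Proof. exact: HopK. Qed.

Lemma ip_Hs_ker y u : Hop u = 0 -> ip (Hs y) u = 0.
Proof. by move=> u0; rewrite ip_Hs u0 mulmx0 mxE. Qed.

Lemma Hop_compl x : Hop (x - P x) = 0.
Proof. by rewrite HopB Hop_P subrr. Qed.

Lemma ip_Hs_P y u : ip (Hs y) (P u) = ip (Hs y) u.
Proof. by rewrite !ip_Hs Hop_P. Qed.

Lemma pythagoras x : `|x| ^+ 2 = `|P x| ^+ 2 + `|x - P x| ^+ 2.
Proof.
have e : x = P x + (x - P x) by rewrite addrC subrK.
rewrite [in LHS]e.
by rewrite [LHS](sqr_normD ipH) (ip_Hs_ker _ (Hop_compl x)) mulr0 addr0.
Qed.

Lemma norm_P_le x : `|P x| <= `|x|.
Proof. by rewrite -ler_sqr ?nnegrE// [leRHS]pythagoras lerDl sqr_ge0. Qed.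

Lemma norm_compl_le x : `|x - P x| <= `|x|.
Proof. by rewrite -ler_sqr ?nnegrE// [leRHS]pythagoras lerDr sqr_ge0. Qed.

Definition obs_dir (i : 'I_k) : H := Hs (delta_mx i 0).

Lemma ip_obs_dir i x : ip x (obs_dir i) = Hop x i 0.
Proof. by rewrite (ipC ipH) ip_Hs trmx_delta -rowE mxE. Qed.

Lemma Hs_sqr_norm y : `|Hs y| ^+ 2 = \sum_(i < k) y i 0 ^+ 2.
Proof.
rewrite -(ipxx ipH) ip_Hs HopK mxE; apply: eq_bigr => i _.
by rewrite mxE expr2.
Qed.

Lemma P_sqr_norm x : `|P x| ^+ 2 = \sum_(i < k) ip x (obs_dir i) ^+ 2.
Proof. by rewrite Hs_sqr_norm; apply: eq_bigr => i _; rewrite ip_obs_dir. Qed.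

(** Bessel and Parseval on the kernel are recorded instead of orthonormality, because Gram-Schmidt
    may emit zero vectors. *)
Definition ker_frame (e : nat -> H) : Prop :=
  [/\ forall n, Hop (e n) = 0,
      forall x N, \sum_(n < N) ip x (e n) ^+ 2 <= `|x - P x| ^+ 2
    & forall x, (fun N => \sum_(n < N) ip x (e n) ^+ 2) @ \oo --> `|x - P x| ^+ 2].

(** The dense sequence is projected by [I - P] and orthonormalised. Since [I - P] does not increase
    norms, the projected sequence is dense in the kernel. *)
Lemma ker_frame_exists : exists e, ker_frame e.
Proof.
have [_ _ _ [s dense]] := ipH.
pose s' n := s n - P (s n).
have e0 n : Hop (gs ip s' n) = 0.
  apply: (@gs_closed _ _ ip s' [set x | Hop x = 0]) => /=; first exact: Hop0.
    by move=> c x y /= x0 y0; rewrite Hop_lin x0 y0 scaler0 addr0.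
  by move=> m; exact: Hop_compl.
have ipe x n : ip x (gs ip s' n) = ip (x - P x) (gs ip s' n).
  by rewrite (ipBl ipH) ip_Hs_ker// subr0.
exists (gs ip s'); split=> // [x N|x].
  under eq_bigr do rewrite ipe.
  exact: gs_bessel.
under eq_fun do under eq_bigr do rewrite ipe.
apply: (gs_parseval ipH) => eps eps0; have [n xn] := dense x eps eps0.
exists n; apply: le_lt_trans xn; rewrite /s'.
have -> : x - P x - (s n - P (s n)) = (x - s n) - P (x - s n).
  by rewrite PprojB !opprB addrACA [RHS]addrACA; congr (_ + _); exact: addrC.
exact: norm_compl_le.
Qed.

Section VNorm.
Variable beta : R.
Hypothesis beta0 : 0 <= beta.

Local Notation V2 := (V2 Hop Hs beta).

(** The polar form of [V2], which gives the projection estimates an inner product. *)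
Definition ipV x y : R := ip x y + beta * ip (P x) (P y).

Lemma V2E x : V2 x = (1 + beta) * `|P x| ^+ 2 + `|x - P x| ^+ 2.
Proof. by rewrite /Defs.V2 [in LHS](pythagoras x); ring. Qed.

Lemma ipVxx x : ipV x x = V2 x.
Proof. by rewrite /ipV !(ipxx ipH). Qed.

Lemma ipVC x y : ipV x y = ipV y x.
Proof. by rewrite /ipV (ipC ipH) (ipC ipH (P x)). Qed.

Lemma ipV_lin (c : R) x y z : ipV (c *: x + y) z = c * ipV x z + ipV y z.
Proof. by rewrite /ipV P_lin !(ip_lin ipH); ring. Qed.

Lemma V2_lincomb (c : R) x y :
  V2 (c *: x + y) = c ^+ 2 * V2 x + 2 * c * ipV x y + V2 y.
Proof.
rewrite -!ipVxx ipV_lin !(ipVC _ (c *: x + y)) !ipV_lin (ipVC y x); ring.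
Qed.

Lemma V2_ge0 x : 0 <= V2 x.
Proof. by rewrite /Defs.V2 addr_ge0 ?mulr_ge0 ?sqr_ge0. Qed.

Lemma sqr_norm_le_V2 x : `|x| ^+ 2 <= V2 x.
Proof. by rewrite /Defs.V2 lerDl mulr_ge0 ?sqr_ge0. Qed.

Lemma V2_le_sqr_norm x : V2 x <= (1 + beta) * `|x| ^+ 2.
Proof.
rewrite /Defs.V2 mulrDl mul1r lerD2l ler_wpM2l//.
by rewrite ler_sqr ?nnegrE// norm_P_le.
Qed.

Lemma V2_compl x : V2 (x - P x) = `|x - P x| ^+ 2.
Proof. by rewrite /Defs.V2 {2}/Pproj Hop_compl Hs0 normr0 expr0n mulr0 addr0. Qed.

(** * Orthogonal projection onto the ball in the V-norm *)

Section Projection.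
Variables (r : R) (PB : H -> H).
Hypothesis PBH : is_Vprojection Hop Hs r beta PB.

Lemma Vproj_ball x : `|PB x| <= r.
Proof. by have [] := PBH x. Qed.

Lemma Vproj_min x v : `|v| <= r -> V2 (x - PB x) <= V2 (x - v).
Proof.
by have [_ +] := PBH x => /[apply]; rewrite /Vnorm ler_sqrt ?V2_ge0.
Qed.

Lemma Vproj_id v : `|v| <= r -> PB v = v.
Proof.
move=> vr; have := Vproj_min v vr; rewrite subrr => h.
have : `|v - PB v| ^+ 2 <= 0.
  apply: (le_trans (sqr_norm_le_V2 _)); apply: (le_trans h).
  by apply: (le_trans (V2_le_sqr_norm _)); rewrite normr0 expr0n mulr0.
rewrite real_exprn_even_le0 ?num_real// normr_eq0 subr_eq0 => /eqP.
by move=> <-.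
Qed.

(** By convexity a small move from [PB x] towards [w] stays in the ball; a positive product would
    make it reduce the distance to [x], against minimality. *)
Lemma Vproj_obtuse x w : `|w| <= r -> ipV (w - PB x) (x - PB x) <= 0.
Proof.
move=> wr; rewrite leNgt; apply/negP; set q := w - PB x; set p := x - PB x.
set g := ipV q p => g0.
have v0 := V2_ge0 q.
have gv : 0 < g + V2 q by rewrite ltr_wpDr.
(* With this [t] the change [- 2 * t * g + t ^+ 2 * V2 q] of the squared distance is at most
   [- t * g]. *)
have [t [t0 t1 e]] : exists t, [/\ 0 < t, t <= 1 & t * V2 q <= g].
  exists (g / (g + V2 q)); split; first by rewrite divr_gt0.
    by rewrite ler_pdivrMr// mul1r lerDl.
  by rewrite mulrAC ler_pdivrMr// ler_wpM2l ?ltW// ltrDr.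
have ball : `|PB x + t *: q| <= r.
  have -> : PB x + t *: q = (1 - t) *: PB x + t *: w.
    by rewrite /q scalerBr scalerBl scale1r addrA addrAC.
  apply: (le_trans (ler_normD _ _)); rewrite !normrZ (ger0_norm (ltW t0)) ger0_norm ?subr_ge0//.
  have -> : r = (1 - t) * r + t * r by ring.
  by rewrite lerD// ler_wpM2l ?subr_ge0 ?Vproj_ball ?(ltW t0).
have := Vproj_min x ball.
have -> : x - (PB x + t *: q) = (- t) *: q + p.
  by rewrite /p scaleNr opprD addrA addrC.
rewrite V2_lincomb -/g -/p.
have : t * (t * V2 q) <= t * g by apply: ler_wpM2l => //; exact: ltW.
have : 0 < t * g by rewrite mulr_gt0.
rewrite sqrrN expr2; lra.
Qed.

(** The two obtuse-angle inequalities add up to [V2 (PB x - PB y) <= ipV (PB x - PB y) (x - y)];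
    nonnegativity of [V2] at the difference of the two arguments then replaces Cauchy-Schwarz. *)
Lemma Vproj_nonexpansive x y : V2 (PB x - PB y) <= V2 (x - y).
Proof.
have h1 := Vproj_obtuse x (Vproj_ball y); have h2 := Vproj_obtuse y (Vproj_ball x).
have ge0 := V2_ge0 ((-1) *: (PB x - PB y) + (x - y)).
rewrite V2_lincomb in ge0.
have e : ipV (PB x - PB y) (x - y) = V2 (PB x - PB y) -
    (ipV (PB y - PB x) (x - PB x) + ipV (PB x - PB y) (y - PB y)).
  have -> : PB y - PB x = (-1) *: (PB x - PB y) + 0 by rewrite scaleN1r opprB addr0.
  rewrite ipV_lin -ipVxx !(ipVC (PB x - PB y)) (ipVC 0).
  have -> : x - y = (1 *: (x - PB x) + ((-1) *: (y - PB y) + (PB x - PB y))).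
    by rewrite scale1r scaleN1r [X in _ = _ + X]addrC opprB !subrKA.
  have ipV0 z : ipV z 0 = 0.
    by rewrite /ipV (ip0r ipH) /Pproj Hop0 Hs0 (ip0r ipH) mulr0 addr0.
  rewrite !ipV_lin ipV0; ring.
rewrite e in ge0; lra.
Qed.

End Projection.
End VNorm.
End Observation.

(** * Upper bounds for integrals of sums and multiples *)

Section Sums.
Context {R : realType} {d : measure_display} {T : measurableType d}.
Variable mu : {measure set T -> \bar R}.

Lemma integral_sum_le n (X : 'I_n -> T -> R) (a : 'I_n -> R) :
  (forall i, measurable_fun setT (X i)) -> (forall i t, 0 <= X i t) ->
  (forall i, (\int[mu]_t (X i t)%:E <= (a i)%:E)%E) ->
  (\int[mu]_t (\sum_(i < n) X i t)%:E <= (\sum_(i < n) a i)%:E)%E.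
Proof.
move=> mX X0 Xa.
under eq_integral do rewrite -sumEFin.
rewrite ge0_integral_sum//.
- by rewrite -sumEFin; apply: lee_sum.
- by move=> i; apply/measurable_EFinP.
- by move=> i t _; rewrite lee_fin.
Qed.

Lemma integral_add_le (X Y : T -> R) (a b : R) :
  measurable_fun setT X -> measurable_fun setT Y ->
  (forall t, 0 <= X t) -> (forall t, 0 <= Y t) ->
  (\int[mu]_t (X t)%:E <= a%:E)%E -> (\int[mu]_t (Y t)%:E <= b%:E)%E ->
  (\int[mu]_t (X t + Y t)%:E <= (a + b)%:E)%E.
Proof.
move=> mX mY X0 Y0 Xa Yb.
under eq_integral do rewrite EFinD.
rewrite ge0_integralD//; first by rewrite EFinD; exact: leeD.
- by move=> t _; rewrite lee_fin.
- by apply/measurable_EFinP.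
- by move=> t _; rewrite lee_fin.
- by apply/measurable_EFinP.
Qed.

Lemma integral_scale_le (X : T -> R) (c a : R) :
  0 <= c -> measurable_fun setT X -> (forall t, 0 <= X t) ->
  (\int[mu]_t (X t)%:E <= a%:E)%E -> (\int[mu]_t (c * X t)%:E <= (c * a)%:E)%E.
Proof.
move=> c0 mX X0 Xa.
under eq_integral do rewrite EFinM.
rewrite ge0_integralZl_EFin//; first by rewrite EFinM; exact: lee_wpmul2l.
- by move=> t _; rewrite lee_fin.
- by apply/measurable_EFinP.
Qed.

End Sums.

(** * Gaussian second moments *)

Section GaussianMoments.
Context {R : realType} {H : completeNormedModType R} (ip : H -> H -> R).
Context (k : nat) (Hop : H -> 'cV[R]_k) (Hs : 'cV[R]_k -> H).
Hypothesis ipH : hilbert_ip ip.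
Hypothesis obsH : obs_operator ip Hop Hs.
Variable e : nat -> H.
Hypothesis eH : ker_frame ip Hop Hs e.

Local Notation P := (Pproj Hop Hs).
Local Notation f := (obs_dir Hs).

Definition V2_partial (beta : R) (N : nat) (x : H) : R :=
  (1 + beta) * (\sum_(i < k) ip x (f i) ^+ 2) + \sum_(n < N) ip x (e n) ^+ 2.

(** Truncation of the mean of [V2 (u - m)] for [u] with covariance [C]; the weight [1 + beta] is
    that of the range of [P] in [V2E]. A finite trace is expressed by bounds uniform in [N]. *)
Definition traceV (beta : R) (C : H -> H) (N : nat) : R :=
  (1 + beta) * (\sum_(i < k) ip (C (f i)) (f i)) + \sum_(n < N) ip (C (e n)) (e n).

Lemma V2_partial_cvg beta x :
  (fun N => V2_partial beta N x) @ \oo --> V2 Hop Hs beta x.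
Proof.
have [_ _ ec] := eH.
rewrite (V2E ipH obsH) /V2_partial (P_sqr_norm ipH obsH).
by apply: cvgD; [exact: cvg_cst|exact: ec].
Qed.

Context {d : measure_display} {T : measurableType d} (u : T -> H).

Section Measurability.
Hypothesis meas_u : forall h, measurable_fun setT (fun t => ip h (u t)).

Lemma measurable_ip_sub h v : measurable_fun setT (fun t => ip (u t - v) h).
Proof.
under eq_fun do rewrite (ipBl ipH) (ipC ipH).
by apply: measurable_funB.
Qed.

Lemma measurable_V2_partial beta N v :
  measurable_fun setT (fun t => V2_partial beta N (u t - v)).
Proof.
apply: measurable_funD.
  apply: measurable_funM => //; apply: measurable_sum => i.
  by apply: measurable_funX; exact: measurable_ip_sub.
by apply: measurable_sum => i; apply: measurable_funX; exact: measurable_ip_sub.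
Qed.

(** Weak measurability of [u] passes to [V2] through the finite coordinate sums. *)
Lemma measurable_V2 beta v : measurable_fun setT (fun t => V2 Hop Hs beta (u t - v)).
Proof.
apply: (measurable_fun_cvg (h := fun N t => V2_partial beta N (u t - v))) => [N|t _].
  exact: measurable_V2_partial.
exact: V2_partial_cvg.
Qed.

Lemma measurable_norm_sub v : measurable_fun setT (fun t => `|u t - v|).
Proof.
have -> : (fun t => `|u t - v|) = (fun x => x `^ 2^-1) \o (fun t => V2 Hop Hs 0 (u t - v)).
  apply/funext => t /=; rewrite /V2 mul0r addr0 powR12_sqrt ?sqr_ge0//.
  by rewrite sqrtr_sqr normr_id.
by apply: measurableT_comp; [exact: measurable_powR|exact: measurable_V2].
Qed.

(* McShane: a Lipschitz [phi] is the infimum of [phi s + K |. - s|] over a dense set. *)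
Lemma measurable_lipschitz_comp (phi : H -> R) (K : R) : 0 <= K ->
  (forall x y, `|phi x - phi y| <= K * `|x - y|) ->
  measurable_fun setT (fun t => phi (u t)).
Proof.
move=> K0 lip; have [_ _ _ [s dense]] := ipH.
pose h n t := phi (s n) + K * `|u t - s n|.
have lb t n : phi (u t) <= h n t.
  by have := lip (u t) (s n); rewrite ler_norml /h => /andP[_]; lra.
have lbt t : has_lbound (range (h ^~ t)).
  by exists (phi (u t)) => _ [n _ <-]; exact: lb.
have -> : (fun t => phi (u t)) = (fun t => infs (h ^~ t) 0%N).
  apply/funext => t; apply/eqP; rewrite eq_le; apply/andP; split.
    apply: lb_le_inf; first by exists (h 0%N t), 0%N.
    by move=> _ [n _ <-]; exact: lb.
  apply/ler_addgt0Pr => eps eps0.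
  (* The factor 2 pays for both the Lipschitz error of [phi] and the penalty term; [K + 1] avoids
     division by zero. *)
  have K1 : 0 < 2 * (K + 1) by rewrite mulr_gt0// ltr_wpDl.
  have [n sn] := dense (u t) (eps / (2 * (K + 1))) (divr_gt0 eps0 K1).
  apply: (@le_trans _ _ (h n t)).
    apply: ge_inf; last by exists n.
    by exists (phi (u t)) => _ [m _ <-]; exact: lb.
  have := lip (s n) (u t); rewrite distrC (distrC (s n)) ler_norml => /andP[+ _].
  have : K * `|u t - s n| <= eps / 2.
    apply: (@le_trans _ _ (K * (eps / (2 * (K + 1))))).
      by apply: ler_wpM2l => //; exact: ltW.
    rewrite mulrA ler_pdivrMr//.
    have -> : eps / 2 * (2 * (K + 1)) = K * eps + eps by field.
    by rewrite lerDl ltW.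
  by rewrite /h; lra.
apply: measurable_fun_infs => // n.
apply: measurable_funD => //; apply: measurable_funM => //.
exact: measurable_norm_sub.
Qed.

End Measurability.

Variable Pr : probability T R.

Section Moments.
Variables (m : H) (C : H -> H).
Hypothesis gaussH : gaussian_elt ip Pr u m C.
Hypothesis homC : forall (s : R) h, ip (C (s *: h)) (s *: h) = s ^+ 2 * ip (C h) h.

Let meas_u h : measurable_fun setT (fun t => ip h (u t)).
Proof. by case: (gaussH h). Qed.

Lemma gauss_cos_moment h v :
  (\int[Pr]_t (cos (ip h (u t - v)))%:E =
     (cos (ip h (m - v)) * expR (- (ip (C h) h / 2)))%:E)%E.
Proof.
have [mh ch sh] := gaussH h.
have mc : measurable_fun setT (fun t => cos (ip h (u t))).
  by apply: measurableT_comp => //; apply: continuous_measurable_fun; exact: continuous_cos.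
have ms : measurable_fun setT (fun t => sin (ip h (u t))).
  by apply: measurableT_comp => //; apply: continuous_measurable_fun; exact: continuous_sin.
have ic := bounded_integrable Pr mc (fun t => cos_max (ip h (u t))) : Pr.-integrable _ _.
have is_ := bounded_integrable Pr ms (fun t => sin_max (ip h (u t))) : Pr.-integrable _ _.
rewrite (EFin_Rintegral ic) in ch; rewrite (EFin_Rintegral is_) in sh.
case: ch => ch; case: sh => sh.
under eq_integral do rewrite (ipBr ipH) cosB EFinD !EFinM.
rewrite integralD//=; last 2 first.
- by apply: integrableZr.
- by apply: integrableZr.
rewrite !integralZr// (EFin_Rintegral ic) (EFin_Rintegral is_) ch sh.
by rewrite (ipBr ipH) cosB -!EFinM -EFinD; congr EFin; ring.
Qed.

(** The characteristic functional at [harmonic n *: h] gives the exact mean of the quotient, and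
    Fatou passes to the limit. As [C] is a bare map, [homC] supplies the quadratic scaling of the
    variance. *)
Lemma gauss_second_moment h v :
  (\int[Pr]_t (ip h (u t - v) ^+ 2)%:E <= (ip h (m - v) ^+ 2 + ip (C h) h)%:E)%E.
Proof.
have mX : measurable_fun setT (fun t => ip h (u t - v)).
  by under eq_fun do rewrite (ipC ipH); exact: measurable_ip_sub.
have mc n : measurable_fun setT (fun t => cos (harmonic n * ip h (u t - v))).
  apply: measurableT_comp; last by apply: measurable_funM.
  by apply: continuous_measurable_fun; exact: continuous_cos.
apply: (@fatou_le _ _ _ Pr
  (fun n t => 2 * (1 - cos (harmonic n * ip h (u t - v))) / harmonic n ^+ 2) _ _ _
  _ _ _ _ (@gauss_quotient_cvg R (ip h (m - v)) (ip (C h) h))).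
- by move=> n; apply: measurable_funM => //; apply: measurable_funM => //; apply: measurable_funB.
- move=> n t; rewrite mulr_ge0 ?invr_ge0 ?sqr_ge0// mulr_ge0// subr_ge0 cos_le1.
- by move=> t; exact: sqr_cos_quotient_cvg.
- move=> n.
  have ic : Pr.-integrable setT (EFin \o fun t => cos (harmonic n * ip h (u t - v))).
    exact: (bounded_integrable Pr (mc n) (fun t => cos_max _)).
  have cn : \int[Pr]_t cos (harmonic n * ip h (u t - v)) =
     cos (harmonic n * ip h (m - v)) * expR (- (harmonic n ^+ 2 * ip (C h) h / 2)).
    apply: EFin_inj; rewrite -(EFin_Rintegral ic).
    under eq_integral do rewrite -(ipZl ipH).
    by rewrite gauss_cos_moment (ipZl ipH) homC.
  have i1 := integrable_cst_prob Pr 1.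
  have ib : Pr.-integrable setT (EFin \o fun t => 1 - cos (harmonic n * ip h (u t - v))).
    by have := integrableB measurableT i1 ic.
  rewrite -cn (_ : (\int[Pr]_t _)%E =
    (\int[Pr]_t (2 / harmonic n ^+ 2 * (1 - cos (harmonic n * ip h (u t - v))))%:E)%E);
    last by apply: eq_integral => t _; rewrite mulrAC.
  rewrite EFin_Rintegral; last first.
    by have := integrableZl measurableT (2 / harmonic n ^+ 2) ib.
  rewrite RintegralZl// RintegralB// Rintegral_cst_prob lee_fin.
  by rewrite mulrAC.
Qed.

Lemma V2_second_moment beta (tau : R) v : 0 <= beta ->
  (forall N, traceV beta C N <= tau) ->
  (\int[Pr]_t (V2 Hop Hs beta (u t - v))%:E <= (V2 Hop Hs beta (m - v) + tau)%:E)%E.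
Proof.
move=> beta0 trC; have b1 : 0 <= 1 + beta by rewrite addr_ge0.
apply: (fatou_le (g := fun N t => V2_partial beta N (u t - v))
  (K := fun N => V2_partial beta N (m - v) + tau)).
- by move=> N; exact: measurable_V2_partial.
- move=> N t; rewrite /V2_partial addr_ge0 ?mulr_ge0 ?sumr_ge0// => i _; exact: sqr_ge0.
- by move=> t; exact: V2_partial_cvg.
- move=> N; apply: (@le_trans _ _ (V2_partial beta N (m - v) + traceV beta C N)%:E).
    have mX h : measurable_fun setT (fun t => ip (u t - v) h ^+ 2).
      by apply: measurable_funX; exact: measurable_ip_sub.
    have sm h : (\int[Pr]_t (ip (u t - v) h ^+ 2)%:E <= (ip (m - v) h ^+ 2 + ip (C h) h)%:E)%E.
      under eq_integral do rewrite (ipC ipH); rewrite (ipC ipH (m - v)).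
      exact: gauss_second_moment.
    have -> : V2_partial beta N (m - v) + traceV beta C N =
      (1 + beta) * (\sum_(i < k) (ip (m - v) (f i) ^+ 2 + ip (C (f i)) (f i))) +
      \sum_(n < N) (ip (m - v) (e n) ^+ 2 + ip (C (e n)) (e n)).
      by rewrite !big_split /= /V2_partial /traceV; ring.
    apply: integral_add_le.
    + by apply: measurable_funM => //; apply: measurable_sum.
    + by apply: measurable_sum.
    + by move=> t; rewrite mulr_ge0// sumr_ge0// => i _; exact: sqr_ge0.
    + by move=> t; rewrite sumr_ge0// => i _; exact: sqr_ge0.
    + apply: integral_scale_le => //; first by apply: measurable_sum.
      * by move=> t; rewrite sumr_ge0// => i _; exact: sqr_ge0.
      * by apply: integral_sum_le => // i t; exact: sqr_ge0.
    + by apply: integral_sum_le => // i t; exact: sqr_ge0.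
  by rewrite lee_fin lerD2l.
- by apply: cvgD; [exact: V2_partial_cvg|exact: cvg_cst].
Qed.

End Moments.
End GaussianMoments.

(** * Forecast step *)

Section Pushforward.
Context {R : realType} {H : completeNormedModType R} (ip : H -> H -> R).
Context (k : nat) (Hop : H -> 'cV[R]_k) (Hs : 'cV[R]_k -> H).
Hypothesis ipH : hilbert_ip ip.
Hypothesis obsH : obs_operator ip Hop Hs.
Variable e : nat -> H.
Hypothesis eH : ker_frame ip Hop Hs e.
Variables (beta r : R) (PB : H -> H).
Hypothesis beta0 : 0 <= beta.
Hypothesis PBH : is_Vprojection Hop Hs r beta PB.

Local Notation P := (Pproj Hop Hs).
Local Notation V2 := (V2 Hop Hs beta).
Local Notation trV := (traceV ip Hs e beta).

(** What the analysis step needs of a forecast covariance besides its trace; [b] will be the bound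
    on the values of the forecast map. *)
Record cov_operator (b : R) (S : H -> H) : Prop := CovOperator {
  cov_lin : forall (c : R) x y, S (c *: x + y) = c *: S x + S y;
  cov_sym : forall x y, ip (S x) y = ip (S y) x;
  cov_ge0 : forall x, 0 <= ip (S x) x;
  cov_le : forall x, ip (S x) x <= b ^+ 2 * `|x| ^+ 2 }.

Variables (F Psi : H -> H) (b LF alpha delta : R).
Hypothesis b0 : 0 <= b.
Hypothesis Fb : forall x, `|x| <= r -> `|F x| <= b.
Hypothesis LF0 : 0 <= LF.
Hypothesis FL : forall x y, `|x| <= r -> `|y| <= r -> V2 (F x - F y) <= LF * V2 (x - y).
Hypothesis alpha01 : 0 < alpha < 1.
Hypothesis Fdelta : forall x, `|x| <= r -> `|(F x - Psi x) - P (F x - Psi x)| <= delta.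
Hypothesis Psi_contr : forall x y, `|x| <= r -> `|y| <= r ->
  V2 ((Psi x - Psi y) - P (Psi x - Psi y)) <= alpha * V2 (x - y).

(** The midpoint of [alpha] and 1: the contraction of [V2] that remains when Young's inequality has
    absorbed the model error, at the price [model_factor]. *)
Definition rate2 : R := (1 + alpha) / 2.
Definition model_factor : R := (1 + alpha) / (1 - alpha).

(* Young's inequality with weight [(1 - alpha) / (2 alpha)]. *)
Lemma young_rate (x y V : R) : 0 <= y -> x ^+ 2 <= alpha * V ->
  (x + y) ^+ 2 <= rate2 * V + model_factor * y ^+ 2.
Proof.
move=> y0 xV; have /andP[a0 a1] := alpha01.
have a1' : 0 < 1 - alpha by rewrite subr_gt0.
have h1 : (1 + alpha) / (2 * alpha) * x ^+ 2 <= rate2 * V.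
  have -> : rate2 * V = (1 + alpha) / (2 * alpha) * (alpha * V).
    by rewrite /rate2; field; rewrite gt_eqF.
  by apply: ler_wpM2l => //; rewrite divr_ge0// ?addr_ge0 ?mulr_ge0 ?ltW.
have h2 : 0 <= ((1 - alpha) * x - 2 * alpha * y) ^+ 2 / (2 * alpha * (1 - alpha)).
  by rewrite divr_ge0 ?sqr_ge0// ?mulr_ge0// ltW.
have h3 : (1 + alpha) / (2 * alpha) * x ^+ 2 + model_factor * y ^+ 2 - (x + y) ^+ 2 =
  ((1 - alpha) * x - 2 * alpha * y) ^+ 2 / (2 * alpha * (1 - alpha)).
  by rewrite /model_factor; field; rewrite !gt_eqF.
rewrite -h3 in h2; lra.
Qed.

(** The difference splits into a difference of [Psi] at two points of the ball, which contracts, and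
    the model error at [PB x], bounded by [delta]. *)
Lemma push_contraction x v :
  `|(F (PB x) - Psi (PB v)) - P (F (PB x) - Psi (PB v))| ^+ 2 <=
  rate2 * V2 (x - v) + model_factor * delta ^+ 2.
Proof.
have [xr vr] := (Vproj_ball PBH x, Vproj_ball PBH v).
set A := Psi (PB x) - Psi (PB v); set B := F (PB x) - Psi (PB x).
have -> : F (PB x) - Psi (PB v) = A + B by rewrite /A /B [RHS]addrC subrKA.
have -> : A + B - P (A + B) = (A - P A) + (B - P B).
  have := P_lin ipH obsH 1 A B; rewrite !scale1r => ->.
  by rewrite opprD addrACA.
have d0 : 0 <= delta := le_trans (normr_ge0 _) (Fdelta xr).
apply: (@le_trans _ _ ((`|A - P A| + delta) ^+ 2)).
  rewrite ler_sqr ?nnegrE ?addr_ge0//; apply: (le_trans (ler_normD _ _)).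
  by rewrite lerD2l; exact: Fdelta.
apply: young_rate => //; rewrite -(V2_compl ipH obsH beta).
apply: (le_trans (Psi_contr xr vr)); apply: ler_wpM2l.
  by have /andP[/ltW] := alpha01.
exact: (Vproj_nonexpansive ipH obsH beta0 PBH).
Qed.

(** This is where the Lipschitz bound on [F] enters: it makes the pushed-forward element weakly
    measurable. *)
Lemma push_lipschitz x y :
  `|F (PB x) - F (PB y)| <= Num.sqrt (LF * (1 + beta)) * `|x - y|.
Proof.
rewrite -ler_sqr ?nnegrE ?mulr_ge0 ?sqrtr_ge0// exprMn sqr_sqrtr ?mulr_ge0 ?addr_ge0//.
apply: (le_trans (sqr_norm_le_V2 Hop Hs beta0 _)); rewrite -mulrA.
apply: (le_trans (FL (Vproj_ball PBH x) (Vproj_ball PBH y))).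
apply: ler_wpM2l => //; apply: (le_trans (Vproj_nonexpansive ipH obsH beta0 PBH _ _)).
exact: (V2_le_sqr_norm ipH obsH beta0).
Qed.

(** * Mean and covariance of the pushed-forward Gaussian *)

Section Moments.
Variables (m : H) (C : H -> H) (mu : H) (Sigma : H -> H).
Context {d : measure_display} {T : measurableType d}.
Variables (Pr : probability T R) (u : T -> H).
Hypothesis gaussH : gaussian_elt ip Pr u m C.
Hypothesis meanH :
  forall h, ((ip mu h)%:E = \int[Pr]_t (ip (F (PB (u t))) h)%:E)%E.
Hypothesis covH : forall h g, ((ip (Sigma h) g)%:E =
  \int[Pr]_t (ip (F (PB (u t)) - mu) h * ip (F (PB (u t)) - mu) g)%:E)%E.

Let Y t := F (PB (u t)).

Let meas_u h : measurable_fun setT (fun t => ip h (u t)).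
Proof. by case: (gaussH h). Qed.

Let Yb t : `|Y t| <= b.
Proof. by apply: Fb; exact: (Vproj_ball PBH). Qed.

Lemma measurable_push c h : measurable_fun setT (fun t => ip (Y t - c) h).
Proof.
apply: (measurable_lipschitz_comp ipH obsH eH meas_u
  (phi := fun x => ip (F (PB x) - c) h) (K := `|h| * Num.sqrt (LF * (1 + beta)))).
  by rewrite mulr_ge0 ?sqrtr_ge0.
move=> x y; rewrite -(ipBl ipH) opprB addrA subrK.
apply: (le_trans (ip_norm_le ipH _ _)); rewrite mulrC -mulrA.
by apply: ler_wpM2l => //; exact: push_lipschitz.
Qed.

Lemma push_bounded c h t : `|ip (Y t - c) h| <= (b + `|c|) * `|h|.
Proof.
apply: (le_trans (ip_norm_le ipH _ _)); apply: ler_wpM2r => //.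
by apply: (le_trans (ler_normB _ _)); rewrite lerD2r.
Qed.

Lemma integrable_push c h : Pr.-integrable setT (EFin \o fun t => ip (Y t - c) h).
Proof. exact: (bounded_integrable Pr (measurable_push c h) (push_bounded c h)). Qed.

Lemma integrable_push2 c h g :
  Pr.-integrable setT (EFin \o fun t => ip (Y t - c) h * ip (Y t - c) g).
Proof.
apply: (bounded_integrable (K := (b + `|c|) * `|h| * ((b + `|c|) * `|g|)) Pr).
  by apply: measurable_funM; exact: measurable_push.
by move=> t; rewrite normrM ler_pM// push_bounded.
Qed.

Lemma push_mean h : ip mu h = \int[Pr]_t ip (Y t - 0) h.
Proof.
apply: EFin_inj; rewrite -(EFin_Rintegral (integrable_push 0 h)) meanH.
by apply: eq_integral => t _; rewrite subr0.
Qed.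

Lemma push_cov h g : ip (Sigma h) g = \int[Pr]_t (ip (Y t - mu) h * ip (Y t - mu) g).
Proof. by apply: EFin_inj; rewrite -(EFin_Rintegral (integrable_push2 mu h g)) covH. Qed.

Lemma push_mean_sub c h : ip (mu - c) h = \int[Pr]_t ip (Y t - c) h.
Proof.
have ic := integrable_cst_prob Pr (ip c h).
rewrite (ipBl ipH) push_mean -[X in _ - X](Rintegral_cst_prob Pr).
rewrite -(RintegralB measurableT (integrable_push 0 h) ic).
by apply: eq_Rintegral => t _; rewrite subr0 (ipBl ipH).
Qed.

(** Bias-variance decomposition. It lets a single integral control the forecast covariance and the
    error of the forecast mean together. *)
Lemma push_second_moment c h :
  ip (Sigma h) h + ip (mu - c) h ^+ 2 = \int[Pr]_t (ip (Y t - c) h ^+ 2).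
Proof.
set z := ip (mu - c) h.
have E t : ip (Y t - c) h ^+ 2 =
    ip (Y t - mu) h * ip (Y t - mu) h + (2 * z * ip (Y t - mu) h + z ^+ 2).
  have -> : Y t - c = (Y t - mu) + (mu - c) by rewrite addrA subrK.
  by rewrite (ipDl ipH) -/z; ring.
have i1 := integrable_push2 mu h h.
have i2 : Pr.-integrable setT (EFin \o fun t => 2 * z * ip (Y t - mu) h).
  by have := integrableZl measurableT (2 * z) (integrable_push mu h).
have i3 := integrable_cst_prob Pr (z ^+ 2).
have i23 : Pr.-integrable setT (EFin \o fun t => 2 * z * ip (Y t - mu) h + z ^+ 2).
  by have := integrableD measurableT i2 i3.
under eq_Rintegral do rewrite E.
rewrite (RintegralD measurableT i1 i23) (RintegralD measurableT i2 i3).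
rewrite (RintegralZl _ measurableT (integrable_push mu h)) -push_mean_sub subrr (ip0l ipH).
by rewrite Rintegral_cst_prob -push_cov mulr0 add0r.
Qed.

(** Testing the second moment about 0 in the direction [mu] gives the fourth power of the norm on
    the left and [b ^+ 2] times its square on the right. *)
Lemma push_mean_bound : `|mu| <= b.
Proof.
have := push_second_moment 0 mu; rewrite subr0 (ipxx ipH) => h.
have cge0 : 0 <= ip (Sigma mu) mu.
  by rewrite push_cov; apply: Rintegral_ge0 => t _; rewrite -expr2 sqr_ge0.
have : \int[Pr]_t (ip (Y t - 0) mu ^+ 2) <= b ^+ 2 * `|mu| ^+ 2.
  apply: Rintegral_le_cst; first exact: integrable_push2.
  move=> t; apply: (le_trans (ip_sqr_le ipH _ _)); apply: ler_wpM2r; first exact: sqr_ge0.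
  by rewrite subr0 ler_sqr ?nnegrE.
rewrite -h => le; have {}le : `|mu| ^+ 2 * `|mu| ^+ 2 <= b ^+ 2 * `|mu| ^+ 2.
  by rewrite -expr2; lra.
have [->|mu0] := eqVneq mu 0; first by rewrite normr0.
by move: le; rewrite ler_pM2r ?exprn_gt0 ?normr_gt0// ler_sqr ?nnegrE.
Qed.

Lemma push_cov_operator : cov_operator b Sigma.
Proof.
split=> [c x y|x y|x|x].
- apply: (ip_ext ipH) => z; rewrite (ip_lin ipH) !push_cov.
  rewrite -(RintegralZl _ measurableT (integrable_push2 mu x z)) -RintegralD//; last 2 first.
  + by have := integrableZl measurableT c (integrable_push2 mu x z).
  + exact: integrable_push2.
  apply: eq_Rintegral => t _.
  by rewrite !(ipC ipH _ (c *: x + y)) (ip_lin ipH) !(ipC ipH (Y t - mu)); ring.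
- by rewrite !push_cov; apply: eq_Rintegral => t _; rewrite mulrC.
- by rewrite push_cov; apply: Rintegral_ge0 => t _; rewrite -expr2 sqr_ge0.
- apply: (@le_trans _ _ (\int[Pr]_t (ip (Y t - 0) x ^+ 2))).
    by rewrite -push_second_moment lerDl sqr_ge0.
  apply: Rintegral_le_cst; first exact: integrable_push2.
  move=> t; apply: (le_trans (ip_sqr_le ipH _ _)); apply: ler_wpM2r; first exact: sqr_ge0.
  by rewrite subr0 ler_sqr ?nnegrE.
Qed.

(** The bias-variance identity is summed over the frame, and Bessel bounds the integrand pointwise
    by the unobserved component. *)
Lemma push_frame_bound c (D : R) (G : T -> R) :
  (forall t, `|(Y t - c) - P (Y t - c)| ^+ 2 <= G t) ->
  (\int[Pr]_t (G t)%:E <= D%:E)%E ->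
  forall N, \sum_(n < N) ip (Sigma (e n)) (e n) +
    \sum_(n < N) ip (mu - c) (e n) ^+ 2 <= D.
Proof.
move=> YG GD N; have [_ eb _] := eH.
rewrite -big_split /=; under eq_bigr do rewrite push_second_moment.
have is_ h : Pr.-integrable setT (EFin \o fun t => ip (Y t - c) h ^+ 2).
  exact: integrable_push2.
rewrite -lee_fin -sumEFin; under eq_bigr do rewrite -(EFin_Rintegral (is_ _)).
rewrite -ge0_integral_sum//; last 2 first.
- by move=> n; exact: (measurable_int _ (is_ (e n))).
- by move=> n t _; rewrite lee_fin sqr_ge0.
apply: le_trans GD; apply: le_integral_ge0 => t.
  by apply: sume_ge0 => n _; rewrite lee_fin sqr_ge0.
by rewrite sumEFin lee_fin; exact: le_trans (eb _ _) (YG t).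
Qed.

Lemma push_trace_bound N : \sum_(n < N) ip (Sigma (e n)) (e n) <= b ^+ 2.
Proof.
have h := @push_frame_bound 0 (b ^+ 2) (fun=> b ^+ 2) _ _ N.
apply: le_trans (h _ _) => {h}; first by rewrite lerDl sumr_ge0// => n _; exact: sqr_ge0.
  move=> t; rewrite subr0 ler_sqr ?nnegrE//.
  exact: le_trans (norm_compl_le ipH obsH _) (Yb t).
by rewrite (EFin_Rintegral (integrable_cst_prob Pr _)) Rintegral_cst_prob.
Qed.

Lemma push_one_step (tau : R) (v : H) :
  (forall (s : R) h, ip (C (s *: h)) (s *: h) = s ^+ 2 * ip (C h) h) ->
  (forall N, trV C N <= tau) ->
  forall N, \sum_(n < N) ip (Sigma (e n)) (e n) +
    \sum_(n < N) ip (mu - Psi (PB v)) (e n) ^+ 2 <=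
    rate2 * (V2 (m - v) + tau) + model_factor * delta ^+ 2.
Proof.
move=> homC trC; have /andP[a0 a1] := alpha01.
apply: (@push_frame_bound _ _ (fun t => rate2 * V2 (u t - v) + model_factor * delta ^+ 2)).
  by move=> t; exact: push_contraction.
have q0 : 0 <= rate2 by rewrite divr_ge0// addr_ge0 ?ltW.
have c0 : 0 <= model_factor * delta ^+ 2.
  by rewrite mulr_ge0 ?sqr_ge0// divr_ge0 ?subr_ge0 ?addr_ge0 ?ltW.
have mV := measurable_V2 ipH obsH eH meas_u beta v.
apply: integral_add_le => //.
- by apply: measurable_funM.
- by move=> t; rewrite mulr_ge0// V2_ge0.
- apply: integral_scale_le => //; first by move=> t; exact: V2_ge0.
  exact: (V2_second_moment ipH obsH eH gaussH homC v beta0 trC).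
- by rewrite (EFin_Rintegral (integrable_cst_prob Pr _)) Rintegral_cst_prob.
Qed.

End Moments.

(** Collects the forecast estimates in a form from which the auxiliary sample space has
    disappeared. *)
Lemma push_facts (m : H) (C : H -> H) (mu : H) (Sigma : H -> H) :
  push_mean_cov ip F PB m C mu Sigma ->
  [/\ cov_operator b Sigma, `|mu| <= b,
      (forall N, \sum_(n < N) ip (Sigma (e n)) (e n) <= b ^+ 2)
    & forall tau : R,
      (forall (s : R) h, ip (C (s *: h)) (s *: h) = s ^+ 2 * ip (C h) h) ->
      (forall N, trV C N <= tau) ->
      (forall N, \sum_(n < N) ip (Sigma (e n)) (e n) <=
         rate2 * tau + model_factor * delta ^+ 2) /\
      (forall v, `|(mu - Psi (PB v)) - P (mu - Psi (PB v))| ^+ 2 <=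
         rate2 * (V2 (m - v) + tau) + model_factor * delta ^+ 2)].
Proof.
move=> [d [T [Pr [u [gaussH meanH covH]]]]].
have cov := push_cov_operator gaussH meanH covH.
split=> //.
- exact: (push_mean_bound gaussH meanH covH).
- exact: (push_trace_bound gaussH meanH covH).
move=> tau homC trC; have step := push_one_step gaussH meanH covH _ homC trC.
split=> [N|v].
  (* With [v = m] the mean error drops out of the right side, leaving a bound by the previous trace
     alone. *)
  have := step m N; rewrite subrr.
  have -> : V2 0 = 0.
    by apply/eqP; rewrite eq_le V2_ge0// andbT;
      apply: (le_trans (V2_le_sqr_norm ipH obsH beta0 _)); rewrite normr0 expr0n mulr0.
  rewrite add0r; apply: le_trans.
  by rewrite lerDl sumr_ge0// => n _; exact: sqr_ge0.
have [_ _ ec] := eH.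
(* Here the trace is dropped instead, and Parseval recovers the full unobserved component. *)
apply: (cvgr_to_le (ec (mu - Psi (PB v)))); apply: nearW => N.
apply: le_trans (step v N).
by rewrite lerDr sumr_ge0// => n _; exact: cov_ge0 cov _.
Qed.

End Pushforward.

(** * Analysis step *)

Section Analysis.
Context {R : realType} {H : completeNormedModType R} (ip : H -> H -> R).
Context (k : nat) (Hop : H -> 'cV[R]_k) (Hs : 'cV[R]_k -> H).
Hypothesis ipH : hilbert_ip ip.
Hypothesis obsH : obs_operator ip Hop Hs.

Local Notation P := (Pproj Hop Hs).

(** Cauchy-Schwarz row by row; the constant is the Frobenius norm of [M]. *)
Lemma obs_norm_mulmx (M : 'M[R]_k) :
  exists2 K : R, 0 <= K & forall y, `|Hs (M *m y)| <= K * `|Hs y|.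
Proof.
exists (Num.sqrt (\sum_(i < k) `|Hs (row i M)^T| ^+ 2)); first exact: sqrtr_ge0.
move=> y; rewrite -ler_sqr ?nnegrE ?mulr_ge0 ?sqrtr_ge0// exprMn sqr_sqrtr; last first.
  by apply: sumr_ge0 => i _; exact: sqr_ge0.
rewrite (Hs_sqr_norm ipH obsH) mulr_suml; apply: ler_sum => i _.
have -> : (M *m y) i 0 = ip (Hs (row i M)^T) (Hs y).
  rewrite (ip_Hs obsH) (HopK obsH) trmxK mxE [RHS]mxE.
  by apply: eq_bigr => l _; rewrite mxE.
exact: ip_sqr_le.
Qed.

Variables (Rn : 'M[R]_k) (eps a b : R) (Sigma : H -> H).
Hypothesis Rn_sym : Rn^T = Rn.
Hypothesis Rn_ge0 : forall y : 'cV[R]_k, 0 <= (y^T *m (Rn *m y)) 0 0.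
Hypothesis a0 : 0 < a.
Hypothesis covS : cov_operator ip b Sigma.

Local Notation S := (inflate Hop Hs a Sigma).
Local Notation K := (gain Hop Hs Rn eps S).

Lemma inflate_lin (c : R) x y : S (c *: x + y) = c *: S x + S y.
Proof.
rewrite /inflate (cov_lin covS) (P_lin ipH obsH) !scalerDr !scalerA (mulrC a).
by rewrite addrACA.
Qed.

Lemma inflateB x y : S (x - y) = S x - S y.
Proof. by have := inflate_lin (-1) y x; rewrite !scaleN1r addrC => ->; rewrite addrC. Qed.

Lemma ip_P_sym x y : ip (P x) y = ip (P y) x.
Proof. by rewrite -(ip_Hs_P obsH) (ipC ipH) (ip_Hs_P obsH). Qed.

Lemma inflate_sym x y : ip (S x) y = ip (S y) x.
Proof. by rewrite !(ipDl ipH) (cov_sym covS) !(ipZl ipH) ip_P_sym. Qed.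

Lemma inflate_quad x : ip (S x) x = ip (Sigma x) x + a * `|P x| ^+ 2.
Proof. by rewrite (ipDl ipH) (ipZl ipH) -(ip_Hs_P obsH) (ipxx ipH). Qed.

Lemma inflate_ge x : a * `|P x| ^+ 2 <= ip (S x) x.
Proof. by rewrite inflate_quad lerDr (cov_ge0 covS). Qed.

Lemma P_Hs y : P (Hs y) = Hs y.
Proof. by rewrite /Pproj (HopK obsH). Qed.

Lemma ip_Hs_Hs y z : ip (Hs y) (Hs z) = (y^T *m z) 0 0.
Proof. by rewrite (ip_Hs obsH) (HopK obsH). Qed.

Lemma innov_mulE y :
  innov_mx Hop Hs Rn eps S *m y = Hop (S (Hs y)) + eps ^+ 2 *: (Rn *m y).
Proof.
pose g z := Hop (S (Hs z)).
have g_lin (c : R) z z' : g (c *: z + z') = c *: g z + g z'.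
  by rewrite /g (Hs_lin ipH obsH) inflate_lin (Hop_lin obsH).
have g0 : g 0 = 0.
  by have := g_lin (-1) 0 0; rewrite scaler0 addr0 scaleN1r addNr.
have gE : g y = \sum_(l < k) y l 0 *: g (delta_mx l 0).
  have gD z z' : g (z + z') = g z + g z' by have := g_lin 1 z z'; rewrite !scale1r.
  rewrite {1}(matrix_sum_delta y) (big_morph g gD g0); apply: eq_bigr => l _.
  by rewrite big_ord1; have := g_lin (y l 0) (delta_mx l 0) 0; rewrite g0 !addr0.
rewrite -/(g y) gE; apply/colP => i; rewrite !mxE summxE mulr_sumr -big_split /=.
by apply: eq_bigr => l _; rewrite !mxE /g; ring.
Qed.

(** The inflation alone makes the innovation matrix coercive, with a constant [a] that is uniform in
    [eps]. *)
Lemma innov_quad_ge y :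
  a * `|Hs y| ^+ 2 <= (y^T *m (innov_mx Hop Hs Rn eps S *m y)) 0 0.
Proof.
rewrite innov_mulE mulmxDr mxE -(ip_Hs obsH) -scalemxAr [X in _ + X]mxE.
rewrite (ipC ipH) -{1}P_Hs; apply: (le_trans (inflate_ge _)).
by rewrite lerDl mulr_ge0 ?sqr_ge0.
Qed.

Lemma innov_unit : innov_mx Hop Hs Rn eps S \in unitmx.
Proof.
rewrite unitmxE unitfE; apply/negP => /det0P[v vn0 vA].
case/negP: vn0; have := innov_quad_ge v^T.
rewrite trmxK mulmxA vA mul0mx mxE => h.
have : `|Hs v^T| ^+ 2 <= 0 by rewrite -(ler_pM2l a0) mulr0.
rewrite real_exprn_even_le0 ?num_real// normr_eq0 => /eqP v0.
by rewrite -(trmxK v) -(HopK obsH v^T) v0 (Hop0 obsH) trmx0.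
Qed.

(** Here [y] is the innovation inverse applied to [z]; later arguments see the gain only through it.
    Coercivity and Cauchy-Schwarz give the norm bound. *)
Lemma gain_spec z : exists y, [/\ K z = S (Hs y),
  z = Hop (S (Hs y)) + eps ^+ 2 *: (Rn *m y),
  0 <= (y^T *m z) 0 0 & `|Hs y| <= `|Hs z| / a].
Proof.
pose A := innov_mx Hop Hs Rn eps S.
have Ay : A *m (invmx A *m z) = z by rewrite mulKVmx// innov_unit.
exists (invmx A *m z); set y := invmx A *m z.
have q : a * `|Hs y| ^+ 2 <= (y^T *m z) 0 0 by have := innov_quad_ge y; rewrite -/A Ay.
split=> //.
- by rewrite -innov_mulE.
- by apply: le_trans q; rewrite mulr_ge0 ?sqr_ge0// ltW.
rewrite ler_pdivlMr// mulrC.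
have [->|y0] := eqVneq (Hs y) 0; first by rewrite normr0 mulr0.
rewrite -(@ler_pM2l _ `|Hs y|) ?normr_gt0//.
apply: le_trans (ip_norm_le ipH _ _); rewrite ip_Hs_Hs.
by apply: le_trans (ler_norm _); apply: le_trans q; rewrite expr2 mulrCA.
Qed.

Lemma gain_lin (c : R) z w : K (c *: z + w) = c *: K z + K w.
Proof. by rewrite /gain mulmxDr -scalemxAr (Hs_lin ipH obsH) inflate_lin. Qed.

Definition posterior_cov : H -> H := fun u => S u - K (Hop (S u)).
Local Notation C := posterior_cov.

Lemma posterior_lin (c : R) x y : C (c *: x + y) = c *: C x + C y.
Proof.
by rewrite /C inflate_lin (Hop_lin obsH) gain_lin scalerBr opprD addrACA.
Qed.

Lemma posterior_hom (s : R) h : ip (C (s *: h)) (s *: h) = s ^+ 2 * ip (C h) h.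
Proof.
have C0 : C 0 = 0.
  by have := posterior_lin (-1) 0 0; rewrite scaler0 addr0 scaleN1r addNr.
have -> : C (s *: h) = s *: C h by have := posterior_lin s h 0; rewrite C0 !addr0.
by rewrite (ipZl ipH) (ipZr ipH); ring.
Qed.

(** On the kernel the inflation vanishes, and the analysis subtracts a nonnegative quadratic form of
    the inverse innovation. *)
Lemma posterior_ker x : Hop x = 0 -> ip (C x) x <= ip (Sigma x) x.
Proof.
move=> x0; have [y [Ky _ yz _]] := gain_spec (Hop (S x)).
rewrite (ipBl ipH) Ky inflate_sym [ip (S _) (Hs y)](ipC ipH) (ip_Hs obsH).
by rewrite inflate_quad /Pproj x0 (Hs0 ipH obsH) normr0 expr0n/= mulr0 addr0; lra.
Qed.

(** The innovation equation for [y] turns the left side into [eps ^+ 2 * Q w y], whatever the size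
    of the forecast covariance. *)
Lemma posterior_obs w :
  ip (C (Hs w)) (Hs w) <= eps ^+ 2 * (w^T *m (Rn *m w)) 0 0.
Proof.
have [y [Ky zE _ _]] := gain_spec (Hop (S (Hs w))).
rewrite (ipBl ipH) Ky.
pose B u v := ip (S (Hs u)) (Hs v); rewrite -/(B w w) -/(B y w).
pose Q (u v : 'cV[R]_k) := (u^T *m (Rn *m v)) 0 0; rewrite -/(Q w w).
have BE u v : B u v = (v^T *m Hop (S (Hs u))) 0 0 by rewrite -(ip_Hs obsH) (ipC ipH).
have eq v : B w v = B y v + eps ^+ 2 * Q v y.
  by rewrite !BE {1}zE mulmxDr -scalemxAr [LHS]mxE [X in _ + X]mxE.
have Qsym u v : Q u v = Q v u.
  have tr1 (M : 'M[R]_1) : M 0 0 = M^T 0 0 by rewrite mxE.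
  by rewrite /Q (tr1 (u^T *m _)) !trmx_mul trmxK Rn_sym mulmxA.
have p0 : 0 <= B (w - y) (w - y).
  apply: le_trans (inflate_ge _); by rewrite mulr_ge0 ?sqr_ge0// ltW.
have q0 := Rn_ge0 (w - y); rewrite -/(Q (w - y) (w - y)) in q0.
have BB : B (w - y) (w - y) = B w w - B y w - (B w y - B y y).
  by rewrite /B (HsB ipH obsH) inflateB (ipBl ipH) !(ipBr ipH); ring.
have QQ : Q (w - y) (w - y) = Q w w - 2 * Q w y + Q y y.
  have -> : Q w w - 2 * Q w y + Q y y = Q w w - Q w y - (Q y w - Q y y).
    by rewrite (Qsym y w); ring.
  by rewrite /Q linearB /= !mulmxBr mulmxBl !mulmxBl !mxE; ring.
(* Positivity of [B] at [w - y] bounds [eps ^+ 2 * Q y y] by [eps ^+ 2 * Q w y]; positivity of [Q]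
   there then bounds the latter by [eps ^+ 2 * Q w w]. *)
have e0 : 0 <= eps ^+ 2 by exact: sqr_ge0.
have := mulr_ge0 e0 q0; rewrite QQ.
by have := eq w; have := eq y; rewrite BB in p0; lra.
Qed.

Variables (e : nat -> H) (beta : R).
Hypothesis eH : ker_frame ip Hop Hs e.
Hypothesis beta0 : 0 <= beta.

Lemma posterior_trace N : traceV ip Hs e beta C N <=
  (1 + beta) * (eps ^+ 2 * \tr Rn) + \sum_(n < N) ip (Sigma (e n)) (e n).
Proof.
apply: lerD; last by apply: ler_sum => n _; apply: posterior_ker; case: eH.
apply: ler_wpM2l; first by rewrite addr_ge0.
rewrite mulr_sumr; apply: ler_sum => i _.
apply: (le_trans (posterior_obs _)).
by rewrite trmx_delta -rowE mxE -colE mxE.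
Qed.

(** Cauchy-Schwarz for the covariance form between [e n] and [g], summed over the frame, makes the
    cross-covariance as small as the root of the unobserved trace. *)
Lemma cov_cross_compl (T : R) g :
  (forall N, \sum_(n < N) ip (Sigma (e n)) (e n) <= T) ->
  `|Sigma g - P (Sigma g)| ^+ 2 <= T * (b ^+ 2 * `|g| ^+ 2).
Proof.
move=> trT; have [_ _ ec] := eH.
apply: (cvgr_to_le (ec (Sigma g))); apply: nearW => N.
apply: (@le_trans _ _ (\sum_(n < N) ip (Sigma (e n)) (e n) * ip (Sigma g) g)).
  apply: ler_sum => n _; rewrite mulrC.
  apply: (@psd_form_CS _ _ (fun x y => ip (Sigma x) y)).
  - exact: cov_sym covS.
  - by move=> c x y z; rewrite (cov_lin covS) (ip_lin ipH).
  - exact: cov_ge0 covS.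
rewrite -mulr_suml; apply: ler_pM => //; last exact: cov_le covS _.
  by apply: sumr_ge0 => n _; exact: cov_ge0 covS _.
exact: cov_ge0 covS _.
Qed.

Hypothesis b0 : 0 <= b.

(** Cauchy-Schwarz for the covariance form at [g] and [Sigma g] upgrades the bound on the form to
    one on the operator. *)
Lemma cov_norm_le g : `|Sigma g| <= b ^+ 2 * `|g|.
Proof.
have h : ip (Sigma g) (Sigma g) ^+ 2 <= ip (Sigma g) g * ip (Sigma (Sigma g)) (Sigma g).
  apply: (@psd_form_CS _ _ (fun x y => ip (Sigma x) y)).
  - exact: cov_sym covS.
  - by move=> c x y z; rewrite (cov_lin covS) (ip_lin ipH).
  - exact: cov_ge0 covS.
have [->|s0] := eqVneq (Sigma g) 0; first by rewrite normr0 mulr_ge0 ?sqr_ge0.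
have : ip (Sigma g) (Sigma g) ^+ 2 <= (b ^+ 2 * `|g| ^+ 2) * (b ^+ 2 * `|Sigma g| ^+ 2).
  apply: (le_trans h); apply: ler_pM; rewrite ?(cov_ge0 covS)//; exact: cov_le covS _.
rewrite (ipxx ipH) [X in X ^+ 2]expr2 exprMn.
have -> : b ^+ 2 * `|g| ^+ 2 * (b ^+ 2 * `|Sigma g| ^+ 2) =
  (b ^+ 2 * `|g|) ^+ 2 * `|Sigma g| ^+ 2 by ring.
rewrite ler_pM2r ?exprn_gt0 ?normr_gt0//.
by rewrite ler_sqr ?nnegrE ?mulr_ge0 ?sqr_ge0.
Qed.

(** The first summand is the response of the unobserved part to noise; the bracket adds up the
    observed-error constants for small and for large [eps]. [B] bounds the forecast error and [KR]
    the action of [Rn]. *)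
Definition analysis_factor (KR B : R) : R :=
  b ^+ 2 / a + (1 + beta) * (KR / a * (B + 1) + 1 + B + (b ^+ 2 / a + 1) * (B + 1)).

(* For [eps <= 1] the observed error is [eps eta - eps^2 R A^-1 z]; for [eps >= 1]
   a bound on the gain that does not degenerate with [eps] is enough. *)
Lemma analysis_obs_error (KR B : R) x eta z :
  0 < eps -> 0 <= KR -> (forall y, `|Hs (Rn *m y)| <= KR * `|Hs y|) -> `|x| <= B ->
  z = - Hop x + eps *: eta -> `|Hs z| <= B + eps * `|Hs eta| ->
  `|P (x + K z)| <= eps *
    ((KR / a * (B + 1) + 1 + B + (b ^+ 2 / a + 1) * (B + 1)) * (1 + `|Hs eta|)).
Proof.
move=> eps0 KR0 RK xB zdef zn; have [y [Ky zE _ yz]] := gain_spec z.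
set n := `|Hs eta|; have n0 : 0 <= n by exact: normr_ge0.
have B0 : 0 <= B := le_trans (normr_ge0 _) xB.
have ia0 : 0 <= a^-1 by rewrite invr_ge0 ltW.
have yn : `|Hs y| <= (B + eps * n) / a.
  by apply: (le_trans yz); apply: ler_wpM2r.
have KRa : 0 <= KR / a by rewrite mulr_ge0.
have ba : 0 <= b ^+ 2 / a by rewrite mulr_ge0 ?sqr_ge0.
have [e1|e1] := leP eps 1.
  have -> : P (x + K z) = eps *: Hs eta - eps ^+ 2 *: Hs (Rn *m y).
    rewrite -!(HsZ ipH obsH) -(HsB ipH obsH) /Pproj (HopD obsH) Ky.
    have -> : Hop (S (Hs y)) = z - eps ^+ 2 *: (Rn *m y) by rewrite {1}zE addrK.
    by rewrite zdef addrA addrA subrr add0r.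
  apply: (le_trans (ler_normB _ _)); rewrite (normrZ eps) (normrZ (eps ^+ 2)) (ger0_norm (sqr_ge0 eps)) gtr0_norm// -/n.
  have : `|Hs (Rn *m y)| <= KR / a * (B + eps * n).
    by apply: (le_trans (RK y)); rewrite -mulrA [a^-1 * _]mulrC; apply: ler_wpM2l.
  move=> /(ler_wpM2l (sqr_ge0 eps)) h.
  apply: (@le_trans _ _ (eps * n + eps ^+ 2 * (KR / a * (B + eps * n)))).
    by rewrite lerD2l.
  rewrite expr2 -mulrA -mulrDr; apply: ler_wpM2l; first exact: ltW.
  have h2 : eps * (KR / a * (B + eps * n)) <= KR / a * (B + n).
    apply: (@le_trans _ _ (1 * (KR / a * (B + n)))); last by rewrite mul1r.
    apply: ler_pM => //; first by rewrite ltW.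
      by rewrite mulr_ge0// addr_ge0// mulr_ge0// ltW.
    by apply: ler_wpM2l => //; rewrite lerD2l ler_piMl.
  apply: (le_trans (lerD (lexx n) h2)); rewrite -subr_ge0.
  have -> : (KR / a * (B + 1) + 1 + B + (b ^+ 2 / a + 1) * (B + 1)) * (1 + n) -
     (n + KR / a * (B + n)) = KR / a * (1 + B * n) + 1 + B * (1 + n) +
       (b ^+ 2 / a + 1) * (B + 1) * (1 + n) by ring.
  by rewrite !addr_ge0 ?mulr_ge0 ?addr_ge0 ?mulr_ge0.
apply: (le_trans (norm_P_le ipH obsH _)); apply: (le_trans (ler_normD _ _)).
have Kz : `|K z| <= (b ^+ 2 / a + 1) * (B + eps * n).
  rewrite Ky /inflate P_Hs; apply: (le_trans (ler_normD _ _)).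
  rewrite normrZ (gtr0_norm a0).
  apply: (le_trans (lerD (cov_norm_le _) (lexx _))); rewrite -mulrDl.
  apply: (@le_trans _ _ ((b ^+ 2 + a) * ((B + eps * n) / a))).
    by apply: ler_wpM2l => //; rewrite addr_ge0 ?sqr_ge0// ltW.
  have -> // : (b ^+ 2 + a) * ((B + eps * n) / a) = (b ^+ 2 / a + 1) * (B + eps * n).
  by field; rewrite gt_eqF.
apply: (le_trans (lerD xB Kz)).
have Be : B <= eps * B by rewrite ler_peMl// ltW.
apply: (@le_trans _ _ (eps * B + (b ^+ 2 / a + 1) * (eps * B + eps * n))).
  by apply: lerD => //; apply: ler_wpM2l; rewrite ?addr_ge0// lerD2r.
have -> : eps * B + (b ^+ 2 / a + 1) * (eps * B + eps * n) =
  eps * (B + (b ^+ 2 / a + 1) * (B + n)) by ring.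
apply: ler_wpM2l; first exact: ltW.
rewrite -subr_ge0.
have -> : (KR / a * (B + 1) + 1 + B + (b ^+ 2 / a + 1) * (B + 1)) * (1 + n) -
   (B + (b ^+ 2 / a + 1) * (B + n)) = KR / a * (B + 1) * (1 + n) + 1 + n + B * n +
     (b ^+ 2 / a + 1) * (1 + B * n) by ring.
by rewrite !addr_ge0 ?mulr_ge0 ?addr_ge0 ?mulr_ge0.
Qed.

(** The unobserved forecast error keeps coefficient 1, so its contraction survives the analysis; the
    gain adds a cross term proportional to [sigma], and all else carries a factor [eps]. *)
Lemma analysis_step (KR B sigma : R) x eta :
  0 < eps -> 0 <= KR -> (forall y, `|Hs (Rn *m y)| <= KR * `|Hs y|) -> `|x| <= B ->
  0 <= sigma <= b -> (forall N, \sum_(n < N) ip (Sigma (e n)) (e n) <= sigma ^+ 2) ->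
  Vnorm Hop Hs beta (x + K (- Hop x + eps *: eta)) <=
    `|x - P x| + sigma * (b / a) * B + eps * (analysis_factor KR B * (1 + `|Hs eta|)).
Proof.
move=> eps0 KR0 RK xB /andP[s0 sb] trs.
pose z := - Hop x + eps *: eta; rewrite -/z.
set n := `|Hs eta|; have n0 : 0 <= n by exact: normr_ge0.
have B0 : 0 <= B := le_trans (normr_ge0 _) xB.
have ba0 : 0 <= b / a by rewrite mulr_ge0// invr_ge0 ltW.
have zn : `|Hs z| <= B + eps * n.
  rewrite /z (HsD ipH obsH) -scaleN1r !(HsZ ipH obsH) scaleN1r.
  apply: (le_trans (ler_normD _ _)); rewrite normrN normrZ gtr0_norm// lerD//.
  exact: le_trans (norm_P_le ipH obsH _) xB.
have obs_le := analysis_obs_error eps0 KR0 RK xB erefl zn.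
have [y [Ky _ _ yz]] := gain_spec z.
have compl_le : `|(x + K z) - P (x + K z)| <=
    `|x - P x| + (sigma * (b / a) * B + eps * (b ^+ 2 / a * n)).
  (* The inflation part of the gain lies in the range of [P], so only [Sigma] contributes here. *)
  have -> : (x + K z) - P (x + K z) = (x - P x) + (Sigma (Hs y) - P (Sigma (Hs y))).
    have PD u v : P (u + v) = P u + P v.
      by have := P_lin ipH obsH 1 u v; rewrite !scale1r.
    have -> : P (x + K z) = P x + (P (Sigma (Hs y)) + a *: Hs y).
      rewrite Ky PD /inflate P_Hs PD; congr (_ + (_ + _)).
      have := P_lin ipH obsH a (Hs y) 0; rewrite addr0 P_Hs => ->.
      by rewrite /Pproj (Hop0 obsH) (Hs0 ipH obsH) addr0.
    rewrite Ky /inflate P_Hs opprD addrACA; congr (_ + _).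
    by rewrite opprD addrACA subrr addr0.
  apply: (le_trans (ler_normD _ _)); rewrite lerD2l.
  have : `|Sigma (Hs y) - P (Sigma (Hs y))| <= sigma * (b * `|Hs y|).
    rewrite -ler_sqr ?nnegrE ?mulr_ge0// exprMn [(b * _) ^+ 2]exprMn.
    exact: cov_cross_compl.
  move=> /le_trans; apply.
  apply: (@le_trans _ _ (sigma * (b / a) * (B + eps * n))).
    rewrite -!mulrA; apply: ler_wpM2l => //; apply: ler_wpM2l => //.
    rewrite mulrC; apply: (le_trans yz); apply: ler_wpM2r => //.
    by rewrite invr_ge0 ltW.
  rewrite mulrDr lerD2l.
  (* In the noise term [sigma] is replaced by [b], as the factor [eps] already makes it small. *)
  have -> : eps * (b ^+ 2 / a * n) = b * (b / a) * (eps * n) by ring.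
  apply: ler_wpM2r; first by rewrite mulr_ge0// ltW.
  exact: ler_wpM2r.
have Vle u : Vnorm Hop Hs beta u <= `|u - P u| + (1 + beta) * `|P u|.
  have b1 : 0 <= 1 + beta by rewrite addr_ge0.
  rewrite -ler_sqr ?nnegrE ?sqrtr_ge0 ?addr_ge0 ?mulr_ge0//.
  rewrite sqr_sqrtr ?V2_ge0// (V2E ipH obsH) sqrrD exprMn -subr_ge0.
  have -> : `|u - P u| ^+ 2 + `|u - P u| * ((1 + beta) * `|P u|) *+ 2 +
    (1 + beta) ^+ 2 * `|P u| ^+ 2 - ((1 + beta) * `|P u| ^+ 2 + `|u - P u| ^+ 2) =
    (1 + beta) * (`|u - P u| * `|P u| *+ 2) + beta * ((1 + beta) * `|P u| ^+ 2) by ring.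
  by rewrite addr_ge0 ?mulr_ge0 ?mulrn_wge0 ?mulr_ge0 ?sqr_ge0.
apply: (le_trans (Vle _)).
have obs_le2 := ler_wpM2l (addr_ge0 ler01 beta0) obs_le.
apply: (le_trans (lerD compl_le obs_le2)); rewrite -/n.
have bn : b ^+ 2 / a * n <= b ^+ 2 / a * (1 + n).
  by apply: ler_wpM2l; [rewrite mulr_ge0 ?sqr_ge0// invr_ge0 ltW|rewrite lerDr].
have := ler_wpM2l (ltW eps0) bn.
rewrite /analysis_factor.
move: (KR / a * (B + 1) + 1 + B + (b ^+ 2 / a + 1) * (B + 1)) => X.
have -> : eps * ((b ^+ 2 / a + (1 + beta) * X) * (1 + n)) =
  eps * (b ^+ 2 / a * (1 + n)) + (1 + beta) * (eps * (X * (1 + n))) by ring.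
move: (eps * (b ^+ 2 / a * n)) (eps * (b ^+ 2 / a * (1 + n)))
  (sigma * (b / a) * B) ((1 + beta) * (eps * (X * (1 + n)))) `|x - P x| => u1 u2 u3 u4 u5.
by lra.
Qed.

End Analysis.

(** * Observation noise *)

Section Noise.
Context {R : realType} {d : measure_display} {Omega : measurableType d}.
Context (Pr : probability Omega R).

Lemma integrable_sum n (X : 'I_n -> Omega -> R) :
  (forall i, Pr.-integrable setT (EFin \o X i)) ->
  Pr.-integrable setT (EFin \o fun w => \sum_(i < n) X i w).
Proof.
elim: n X => [|n IH] X iX.
  by under [X in EFin \o X]eq_fun do rewrite big_ord0; exact: integrable_cst_prob.
under [X in EFin \o X]eq_fun do rewrite big_ord_recr.
by have := integrableD measurableT (IH _ (fun i => iX (widen_ord (leqnSn n) i))) (iX ord_max).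
Qed.

Lemma Rintegral_sum n (X : 'I_n -> Omega -> R) :
  (forall i, Pr.-integrable setT (EFin \o X i)) ->
  \int[Pr]_w (\sum_(i < n) X i w) = \sum_(i < n) \int[Pr]_w X i w.
Proof.
elim: n X => [|n IH] X iX.
  rewrite big_ord0 -[RHS](Rintegral_cst_prob Pr).
  by apply: eq_Rintegral => w _; rewrite big_ord0.
rewrite big_ord_recr /= -IH//.
rewrite -(RintegralD measurableT (integrable_sum (fun i => iX (widen_ord (leqnSn n) i))) (iX ord_max)).
by apply: eq_Rintegral => w _; rewrite big_ord_recr.
Qed.

Context (k : nat) (eta : nat -> Omega -> 'cV[R]_k) (Rn : 'M[R]_k).
Hypothesis noiseH : noise_seq Pr eta Rn.

Lemma noise_integrable2 j i l :
  Pr.-integrable setT (EFin \o fun w => eta j w i 0 * eta j w l 0).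
Proof. by have [_ _ _ [h _ _]] := noiseH; exact: h. Qed.

Lemma noise_cov j i l : Rn i l = \int[Pr]_w (eta j w i 0 * eta j w l 0).
Proof.
have [_ _ _ [_ h _]] := noiseH; apply: EFin_inj.
by rewrite -(EFin_Rintegral (noise_integrable2 j i l)) h.
Qed.

Lemma noise_cov_sym : Rn^T = Rn.
Proof.
apply/matrixP => i l; rewrite mxE !(noise_cov 0).
by apply: eq_Rintegral => w _; rewrite mulrC.
Qed.

(** The form is the second moment of the linear functional of one noise vector with coefficients
    [y]. *)
Lemma noise_cov_ge0 (y : 'cV[R]_k) : 0 <= (y^T *m (Rn *m y)) 0 0.
Proof.
have iq i l : Pr.-integrable setT
    (EFin \o fun w => y i 0 * y l 0 * (eta 0%N w i 0 * eta 0%N w l 0)).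
  by have := integrableZl measurableT (y i 0 * y l 0) (noise_integrable2 0 i l).
have -> : (y^T *m (Rn *m y)) 0 0 = \int[Pr]_w ((\sum_(i < k) y i 0 * eta 0%N w i 0) ^+ 2).
  transitivity (\sum_(i < k) \sum_(l < k)
      \int[Pr]_w (y i 0 * y l 0 * (eta 0%N w i 0 * eta 0%N w l 0))).
    rewrite mxE; apply: eq_bigr => i _; rewrite !mxE mulr_sumr; apply: eq_bigr => l _.
    rewrite (RintegralZl _ measurableT (noise_integrable2 0 i l)) -noise_cov; ring.
  under eq_bigr do rewrite -Rintegral_sum//.
  rewrite -Rintegral_sum; last by move=> i; exact: integrable_sum.
  apply: eq_Rintegral => w _; rewrite expr2 mulr_suml; apply: eq_bigr => i _.
  by rewrite mulr_sumr; apply: eq_bigr => l _; ring.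
by apply: Rintegral_ge0 => w _; exact: sqr_ge0.
Qed.

Lemma noise_trace_ge0 : 0 <= \tr Rn.
Proof.
apply: sumr_ge0 => i _; rewrite (noise_cov 0); apply: Rintegral_ge0 => w _.
by rewrite -expr2 sqr_ge0.
Qed.

Lemma noise_sqr_integrable j :
  Pr.-integrable setT (EFin \o fun w => \sum_(i < k) eta j w i 0 ^+ 2).
Proof. by apply: integrable_sum => i; exact: noise_integrable2. Qed.

Lemma noise_sqr_mean j : \int[Pr]_w (\sum_(i < k) eta j w i 0 ^+ 2) = \tr Rn.
Proof.
rewrite Rintegral_sum; last by move=> i; exact: noise_integrable2.
by apply: eq_bigr => i _; rewrite (noise_cov j).
Qed.

End Noise.

(** * Affine recursions with random forcing and their upper limits *)

Fixpoint affine_rec {R : realType} {Omega : Type} (rho K : R) (g : nat -> Omega -> R) (i : nat) (w : Omega) : R :=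
  if i is p.+1 then rho * affine_rec rho K g p w + g p.+1 w else K + g 0%N w.

Section Recursion.
Context {R : realType} {d : measure_display} {Omega : measurableType d}.
Context (Pr : probability Omega R).

(** The mean obeys an affine recursion with fixed point [G / (1 - rho)]. The initial value already
    contains [g 0], since the first error considered has passed one noisy analysis. *)
Lemma affine_rec_mean (rho K G : R) (g : nat -> Omega -> R) : 0 <= rho < 1 ->
  (forall i, Pr.-integrable setT (EFin \o g i)) ->
  0 <= G -> (forall i, \int[Pr]_w g i w = G) ->
  forall i, Pr.-integrable setT (EFin \o affine_rec rho K g i) /\
    \int[Pr]_w affine_rec rho K g i w <= rho ^+ i * K + G / (1 - rho).
Proof.
move=> /andP[r0 r1] ig G0 Eg; have r1' : 0 < 1 - rho by rewrite subr_gt0.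
elim=> [|i [IHi IH]].
  have ic := integrable_cst_prob Pr K.
  split; first by have := integrableD measurableT ic (ig 0%N).
  rewrite /= (RintegralD measurableT ic (ig 0%N)) Rintegral_cst_prob Eg expr0 mul1r lerD2l.
  by rewrite ler_pdivlMr// ler_piMr// gerBl.
have is_ : Pr.-integrable setT (EFin \o fun w => rho * affine_rec rho K g i w).
  by have := integrableZl measurableT rho IHi.
split; first by have := integrableD measurableT is_ (ig i.+1).
rewrite /= (RintegralD measurableT is_ (ig i.+1)) (RintegralZl _ measurableT IHi) Eg.
apply: (le_trans (lerD (ler_wpM2l r0 IH) (lexx G))).
rewrite le_eqVlt; apply/orP; left; apply/eqP.
by rewrite exprS; field; rewrite gt_eqF.
Qed.

Lemma limn_esup_geometric_le (x : nat -> \bar R) (n0 : nat) (rho K c : R) :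
  0 <= rho < 1 -> (forall i, (x (n0 + i)%N <= (rho ^+ i * K + c)%:E)%E) ->
  (limn_esup x <= c%:E)%E.
Proof.
move=> /andP[r0 r1] xle.
(* The subtraction is truncated below [n0], which leaves the tail unchanged. *)
pose v n := rho ^+ (n - n0) * K + c.
have vc : v @ \oo --> c.
  have e : c = 0 * K + c by rewrite mul0r add0r.
  rewrite [X in _ --> X]e; apply: cvgD; last exact: cvg_cst.
  apply: cvgMl; rewrite -(cvg_shiftn n0) /=.
  under eq_fun do rewrite addnK.
  by apply: cvg_expr; rewrite ger0_norm.
have [_ <-] := cvg_limn_einf_sup (cvgn_EFin vc).
rewrite !limn_esup_lim; apply: lee_lim; [exact: is_cvg_esups|exact: is_cvg_esups|].
exists n0 => // n /= n0n; apply: ge_ereal_sup => _ [m /= nm <-].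
apply: (@le_trans _ _ (v m)%:E).
  by have := xle (m - n0)%N; rewrite subnKC// (leq_trans n0n).
by apply: ereal_sup_ubound; exists m.
Qed.

End Recursion.

(** * Error recursion *)

Section FilterError.
Context {R : realType} {H : completeNormedModType R} (ip : H -> H -> R).
Context (k : nat) (Hop : H -> 'cV[R]_k) (Hs : 'cV[R]_k -> H).
Hypothesis ipH : hilbert_ip ip.
Hypothesis obsH : obs_operator ip Hop Hs.
Variable e : nat -> H.
Hypothesis eH : ker_frame ip Hop Hs e.
Variables (beta r alpha kappa a KR : R) (Rn : 'M[R]_k) (Psi PB : H -> H) (u0 m0 : H) (C0 : H -> H).
Hypothesis r0 : 0 < r.
Hypothesis kappa0 : 0 < kappa.
Hypothesis a0 : 0 < a.
Hypothesis beta0 : 0 <= beta.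
Hypothesis alpha01 : 0 < alpha < 1.
Hypothesis PBH : is_Vprojection Hop Hs r beta PB.
Hypothesis Rn_sym : Rn^T = Rn.
Hypothesis Rn_ge0 : forall y : 'cV[R]_k, 0 <= (y^T *m (Rn *m y)) 0 0.
Hypothesis trR0 : 0 <= \tr Rn.
Hypothesis KR0 : 0 <= KR.
Hypothesis RK : forall y, `|Hs (Rn *m y)| <= KR * `|Hs y|.
Hypothesis Psi_ball : forall x, `|x| <= r -> `|Psi x| <= r.
Hypothesis Psi_contr : forall x y, `|x| <= r -> `|y| <= r ->
  V2 Hop Hs beta ((Psi x - Psi y) - Pproj Hop Hs (Psi x - Psi y)) <=
  alpha * V2 Hop Hs beta (x - y).

Local Notation P := (Pproj Hop Hs).
Local Notation V2 := (V2 Hop Hs beta).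
Local Notation Vnorm := (Vnorm Hop Hs beta).
Local Notation trV := (traceV ip Hs e beta).
Local Notation b := (r + kappa).
Local Notation B := (r + kappa + r).
Local Notation cd := (model_factor alpha).
Local Notation rho := (Num.sqrt (rate2 alpha)).
Local Notation rho' := ((1 + Num.sqrt (rate2 alpha)) / 2).
Local Notation AF := (analysis_factor a b beta KR B).

Definition trace_const : R := Num.sqrt cd + Num.sqrt ((1 + beta) * \tr Rn).
(** A root of the forecast trace enters the mean error once through the forecast and once, times
    [b / a * B], through the cross term of the gain. *)
Definition gain_const : R := 1 + b / a * B.
(** The weight [c] solving [gain_const * rho + c * rho = c * rho'], with [rho'] the midpoint of
    [rho] and 1. *)
Definition lyapunov_weight : R := gain_const * rho / (rho' - rho).
Definition error_const : R :=
  gain_const * Num.sqrt cd + 2 * AF + lyapunov_weight * trace_const.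

Lemma rate2_ge0 : 0 <= rate2 alpha.
Proof. by rewrite /rate2; have /andP[] := alpha01; lra. Qed.

Lemma rate_lt1 : rho < 1.
Proof.
rewrite -[X in _ < X]sqrtr1 ltr_sqrt//; rewrite /rate2.
by have /andP[] := alpha01; lra.
Qed.

Lemma rate'_gt : rho < rho'.
Proof. by have := rate_lt1; lra. Qed.

Lemma rate'01 : 0 <= rho' < 1.
Proof. by have := rate_lt1; have := sqrtr_ge0 (rate2 alpha); lra. Qed.

Lemma model_factor_ge0 : 0 <= cd.
Proof. by have /andP[? ?] := alpha01; rewrite divr_ge0 ?subr_ge0 ?addr_ge0// ltW. Qed.

Lemma b_ge0 : 0 <= b.
Proof. by rewrite addr_ge0// ltW. Qed.

Lemma gain_const_ge0 : 0 <= gain_const.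
Proof.
apply: addr_ge0 => //; apply: mulr_ge0; first exact: divr_ge0 b_ge0 (ltW a0).
exact: addr_ge0 b_ge0 (ltW r0).
Qed.

Lemma lyapunov_weight_ge0 : 0 <= lyapunov_weight.
Proof.
by rewrite divr_ge0 ?mulr_ge0 ?gain_const_ge0 ?sqrtr_ge0// subr_ge0 ltW// rate'_gt.
Qed.

Lemma analysis_factor_ge0 : 0 <= AF.
Proof.
have ? := b_ge0; have ia : 0 <= a^-1 by rewrite invr_ge0 ltW.
rewrite /analysis_factor; do ![apply: addr_ge0 | apply: mulr_ge0 => //] => //;
  rewrite ?sqr_ge0 ?(ltW r0) ?(ltW kappa0)//.
Qed.

Lemma trace_const_ge0 : 0 <= trace_const.
Proof. by rewrite addr_ge0 ?sqrtr_ge0. Qed.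

Lemma error_const_ge0 : 0 <= error_const.
Proof.
apply: addr_ge0; last exact: mulr_ge0 lyapunov_weight_ge0 trace_const_ge0.
apply: addr_ge0; first exact: mulr_ge0 gain_const_ge0 (sqrtr_ge0 _).
exact: mulr_ge0 (ler0n _ 2) analysis_factor_ge0.
Qed.

Variables (eps delta LF : R) (F : H -> H).
Hypothesis eps0 : 0 < eps.
Hypothesis delta0 : 0 < delta.
Hypothesis LF0 : 0 <= LF.
Hypothesis Fb : forall x, `|x| <= r -> `|F x| <= b.
Hypothesis FL : forall x y, `|x| <= r -> `|y| <= r -> V2 (F x - F y) <= LF * V2 (x - y).
Hypothesis Fdelta : forall x, `|x| <= r -> `|(F x - Psi x) - P (F x - Psi x)| <= delta.

Variables (Omega : Type) (eta : nat -> Omega -> 'cV[R]_k).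
Variables (m : nat -> Omega -> H) (C : nat -> Omega -> H -> H).
Hypothesis GPFH : GPF ip Hop Hs F PB Rn eps a m0 C0
  (fun j w => Hop (iter j Psi u0) + eps *: eta j w) m C.

Local Notation u j := (iter j Psi u0).

(** A bound on the root of the trace of [C i.+1]. The count starts after one analysis step because
    [C0] is an arbitrary map and only the forecast through the ball yields the initial bound [b]. *)
Fixpoint trace_root (i : nat) : R :=
  if i is p.+1 then rho * trace_root p + trace_const * (delta + eps)
  else b + trace_const * (delta + eps).

Lemma trace_root_ge0 i : 0 <= trace_root i.
Proof.
have h : 0 <= trace_const * (delta + eps).
  by rewrite mulr_ge0 ?trace_const_ge0// addr_ge0// ltW.
elim: i => [|i IH] /=; first exact: addr_ge0 b_ge0 h.
exact: addr_ge0 (mulr_ge0 (sqrtr_ge0 _) IH) h.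
Qed.

Lemma filter_step j w : exists (mu : H) (Sigma : H -> H),
  let S := inflate Hop Hs a Sigma in
  [/\ push_mean_cov ip F PB (m j w) (C j w) mu Sigma,
      m j.+1 w - u j.+1 = (mu - u j.+1) + gain Hop Hs Rn eps S
        (- Hop (mu - u j.+1) + eps *: eta j.+1 w)
    & C j.+1 w = posterior_cov Hop Hs Rn eps a Sigma].
Proof.
have [_ _ /(_ j w)[mu [Sigma [pm mE CE]]]] := GPFH.
exists mu, Sigma; split=> //; rewrite mE addrAC; congr (_ + gain _ _ _ _ _ _).
by rewrite (HopB obsH) opprB addrAC.
Qed.

(** Converts recursions for squared quantities into linear recursions for their roots. *)
Lemma sqr_add_sqrt_le (x y z t : R) : 0 <= x -> 0 <= y -> 0 <= z -> 0 <= t ->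
  x * y ^+ 2 + z * t ^+ 2 <= (Num.sqrt x * y + Num.sqrt z * t) ^+ 2.
Proof.
move=> x0 y0 z0 t0; rewrite sqrrD !exprMn !sqr_sqrtr//.
by rewrite -addrA [X in _ <= _ + X]addrC lerD2l lerDl mulrn_wge0 ?mulr_ge0 ?sqrtr_ge0.
Qed.

Lemma forecast_bounds i w mu Sigma :
  push_mean_cov ip F PB (m i w) (C i w) mu Sigma ->
  [/\ cov_operator ip b Sigma, `|mu| <= b,
      (forall N, \sum_(n < N) ip (Sigma (e n)) (e n) <= b ^+ 2)
    & forall tau : R,
      (forall (s : R) h, ip (C i w (s *: h)) (s *: h) = s ^+ 2 * ip (C i w h) h) ->
      (forall N, trV (C i w) N <= tau) ->
      (forall N, \sum_(n < N) ip (Sigma (e n)) (e n) <=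
         rate2 alpha * tau + cd * delta ^+ 2) /\
      (forall v, `|(mu - Psi (PB v)) - P (mu - Psi (PB v))| ^+ 2 <=
         rate2 alpha * (V2 (m i w - v) + tau) + cd * delta ^+ 2)].
Proof.
exact: (push_facts ipH obsH eH beta0 PBH b_ge0 Fb LF0 FL alpha01 Fdelta Psi_contr).
Qed.

(** Homogeneity and the trace bound are carried through one induction, since the next Gaussian
    moment estimate needs both. *)
Lemma posterior_trace_bound i w :
  (forall (s : R) h, ip (C i.+1 w (s *: h)) (s *: h) = s ^+ 2 * ip (C i.+1 w h) h) /\
  (forall N, trV (C i.+1 w) N <= trace_root i ^+ 2).
Proof.
have tcE : trace_const * (delta + eps) =
    (Num.sqrt cd * delta + Num.sqrt ((1 + beta) * \tr Rn) * eps) +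
    (Num.sqrt cd * eps + Num.sqrt ((1 + beta) * \tr Rn) * delta).
  by rewrite /trace_const; ring.
have tr' : 0 <= (1 + beta) * \tr Rn by rewrite mulr_ge0 ?addr_ge0.
have [d0' e0'] := (ltW delta0, ltW eps0).
have extra : 0 <= Num.sqrt cd * eps + Num.sqrt ((1 + beta) * \tr Rn) * delta.
  by rewrite addr_ge0 ?mulr_ge0 ?sqrtr_ge0.
have combine (T : R) Sigma : 0 <= T -> cov_operator ip b Sigma ->
    (forall N, \sum_(n < N) ip (Sigma (e n)) (e n) <= T ^+ 2) ->
    forall N, trV (posterior_cov Hop Hs Rn eps a Sigma) N <=
      (T + Num.sqrt ((1 + beta) * \tr Rn) * eps) ^+ 2.
  move=> T0 cov trT N.
  apply: (le_trans (posterior_trace ipH obsH eps Rn_sym Rn_ge0 a0 cov eH beta0 N)).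
  have := sqr_add_sqrt_le ler01 T0 tr' e0'; rewrite sqrtr1 !mul1r.
  by have := trT N; lra.
have sqr_le (x y : R) : 0 <= x -> x <= y -> x ^+ 2 <= y ^+ 2.
  by move=> x0 xy; rewrite ler_sqr ?nnegrE// (le_trans x0).
have e1 : 0 <= Num.sqrt ((1 + beta) * \tr Rn) * eps by rewrite mulr_ge0 ?sqrtr_ge0.
elim: i => [|i [IHh IHt]].
  have [mu [Sigma [pm _ ->]]] := filter_step 0%N w.
  have [cov _ trb _] := forecast_bounds pm.
  split; first exact: (posterior_hom ipH obsH Rn eps a cov).
  move=> N; apply: (le_trans (combine b Sigma b_ge0 cov trb N)).
  apply: sqr_le; first exact: addr_ge0 b_ge0 e1.
  rewrite /= tcE; have : 0 <= Num.sqrt cd * delta by rewrite mulr_ge0 ?sqrtr_ge0.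
  by lra.
have [mu [Sigma [pm _ ->]]] := filter_step i.+1 w.
have [cov _ _ step] := forecast_bounds pm.
have [trS _] := step _ IHh IHt.
split; first exact: (posterior_hom ipH obsH Rn eps a cov).
have T0 : 0 <= rho * trace_root i + Num.sqrt cd * delta.
  by rewrite addr_ge0 ?mulr_ge0 ?sqrtr_ge0 ?trace_root_ge0.
move=> N; apply: (le_trans (combine _ Sigma T0 cov _ N)).
  move=> N'; apply: (le_trans (trS N')).
  exact: (sqr_add_sqrt_le rate2_ge0 (trace_root_ge0 i) model_factor_ge0 d0').
apply: sqr_le; first exact: addr_ge0 T0 e1.
by rewrite /= tcE; lra.
Qed.

Lemma mean_error_crude i w : `|u i.+1| <= r ->
  Vnorm (m i.+1 w - u i.+1) <= B + b * (b / a) * B + eps * (AF * (1 + `|Hs (eta i.+1 w)|)).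
Proof.
move=> ur; have [mu [Sigma [pm -> _]]] := filter_step i w.
have [cov mub trb _] := forecast_bounds pm.
have xB : `|mu - u i.+1| <= B by apply: (le_trans (ler_normB _ _)); exact: lerD.
have bb : 0 <= b <= b by rewrite b_ge0 lexx.
apply: (le_trans (analysis_step ipH obsH Rn_ge0 a0 cov eH beta0 b_ge0 _ eps0 KR0 RK xB bb trb)).
by rewrite !lerD2r; exact: le_trans (norm_compl_le ipH obsH _) xB.
Qed.

Lemma mean_error_step i w : `|u i.+1| <= r ->
  Vnorm (m i.+2 w - u i.+2) <= rho * Vnorm (m i.+1 w - u i.+1) +
    gain_const * (rho * trace_root i + Num.sqrt cd * delta) +
    eps * (AF * (1 + `|Hs (eta i.+2 w)|)).
Proof.
move=> ur; have [mu [Sigma [pm -> _]]] := filter_step i.+1 w.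
have [cov mub trb step] := forecast_bounds pm.
have [hom trC] := posterior_trace_bound i w.
have [trS /(_ (u i.+1))] := step _ hom trC.
(* The signal lies in the ball, where [PB] is the identity, so the forecast is compared with the
   next signal state. *)
rewrite (Vproj_id ipH obsH beta0 PBH ur) -[Psi (u i.+1)]/(u i.+2) => complx.
have s0 := trace_root_ge0 i; have d0' := ltW delta0.
have xB : `|mu - u i.+2| <= B.
  by apply: (le_trans (ler_normB _ _)); apply: lerD => //; exact: Psi_ball.
pose T := rho * trace_root i + Num.sqrt cd * delta.
have T0 : 0 <= T by rewrite addr_ge0 ?mulr_ge0 ?sqrtr_ge0.
(* The analysis estimate asks for a root of the trace bound not above [b]; both [T] and [b] are
   valid roots, hence so is their minimum. *)
pose sg := Num.min T b.
have sgb : 0 <= sg <= b by rewrite le_min T0 b_ge0 ge_min lexx orbT.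
have trsg N : \sum_(n < N) ip (Sigma (e n)) (e n) <= sg ^+ 2.
  have [h|h] := leP T b; last by rewrite /sg (min_r (ltW h)).
  rewrite /sg (min_l h).
  apply: (le_trans (trS N)).
  exact: (sqr_add_sqrt_le rate2_ge0 s0 model_factor_ge0 d0').
apply: (le_trans (analysis_step ipH obsH Rn_ge0 a0 cov eH beta0 b_ge0 _ eps0 KR0 RK xB sgb trsg)).
rewrite lerD2r.
have V0 : 0 <= Vnorm (m i.+1 w - u i.+1) by exact: sqrtr_ge0.
have c1 : `|(mu - u i.+2) - P (mu - u i.+2)| <= rho * Vnorm (m i.+1 w - u i.+1) + T.
  rewrite -ler_sqr ?nnegrE ?addr_ge0 ?mulr_ge0 ?sqrtr_ge0//.
  apply: (le_trans complx).
  have -> : V2 (m i.+1 w - u i.+1) = Vnorm (m i.+1 w - u i.+1) ^+ 2.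
    by rewrite sqr_sqrtr// V2_ge0.
  move: (Vnorm _) V0 => v v0.
  have h1 := sqr_add_sqrt_le rate2_ge0 (addr_ge0 v0 s0) model_factor_ge0 d0'.
  rewrite /T addrA -mulrDr; apply: le_trans h1; rewrite lerD2r.
  apply: ler_wpM2l; first exact: rate2_ge0.
  by rewrite sqrrD addrAC lerDl mulrn_wge0// mulr_ge0.
have c2 : sg * (b / a) * B <= T * (b / a) * B.
  have ? := b_ge0.
  apply: ler_wpM2r; first by rewrite addr_ge0// ltW.
  by apply: ler_wpM2r; rewrite ?divr_ge0 ?(ltW a0)// /sg ge_min lexx.
apply: (le_trans (lerD c1 c2)); rewrite -addrA lerD2l /gain_const -/T.
by rewrite le_eqVlt; apply/orP; left; apply/eqP; ring.
Qed.

(** The squared noise is used because its mean is exactly [\tr Rn]; the deterministic part absorbs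
    the sources from model error and from the trace. *)
Definition noise_level (j : nat) (w : Omega) : R :=
  delta + eps * (1 + \sum_(i < k) eta j w i 0 ^+ 2).

Lemma noise_level_ge j w : eps * (AF * (1 + `|Hs (eta j w)|)) <= 2 * AF * noise_level j w.
Proof.
have A0 := analysis_factor_ge0.
rewrite /noise_level -(Hs_sqr_norm ipH obsH); set n := `|_|.
have n2 : 1 + n <= 2 * (1 + n ^+ 2).
  by have := sqr_ge0 (n - 1); rewrite sqrrB1; have := sqr_ge0 n; rewrite -mulr_natr; lra.
have h : eps * (AF * (1 + n)) <= eps * (AF * (2 * (1 + n ^+ 2))).
  by apply: ler_wpM2l; [exact: ltW|exact: ler_wpM2l].
apply: (le_trans h).
have -> : 2 * AF * (delta + eps * (1 + n ^+ 2)) =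
  2 * AF * delta + eps * (AF * (2 * (1 + n ^+ 2))) by ring.
by rewrite lerDr !mulr_ge0// ltW.
Qed.

Lemma noise_level_lb j w : delta + eps <= noise_level j w.
Proof.
rewrite /noise_level mulrDr mulr1 addrA lerDl mulr_ge0 ?(ltW eps0)//.
by apply: sumr_ge0 => i _; exact: sqr_ge0.
Qed.

(* The Lyapunov function is the [V]-error of the mean plus a multiple of the
   square-root bound on the trace. *)
Lemma filter_error_bound (J : nat) :
  (forall j, (J <= j)%N -> `|u j| <= r) ->
  forall i w, Vnorm (m (J + i).+1 w - u (J + i).+1) <=
    affine_rec rho'
      (B + b * (b / a) * B + lyapunov_weight * trace_root J)
      (fun i w => error_const * noise_level (J + i).+1 w) i w.
Proof.
move=> uB i w; have Kz0 := lyapunov_weight_ge0.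
have [G0 A0] := (gain_const_ge0, analysis_factor_ge0).
have d0' := ltW delta0.
have N0 j : 0 <= noise_level j w.
  by apply: le_trans (noise_level_lb j w); rewrite addr_ge0// ltW.
have dN j : delta <= noise_level j w.
  by apply: le_trans (noise_level_lb j w); rewrite lerDl ltW.
suff : Vnorm (m (J + i).+1 w - u (J + i).+1) + lyapunov_weight * trace_root (J + i) <=
    affine_rec rho'
      (B + b * (b / a) * B + lyapunov_weight * trace_root J)
      (fun i w => error_const * noise_level (J + i).+1 w) i w.
  by apply: le_trans; rewrite lerDl mulr_ge0 ?trace_root_ge0.
elim: i => [|i IH].
  rewrite addn0 /= addn0.
  have := mean_error_crude w (uB J.+1 (leqnSn J)).
  have := noise_level_ge J.+1 w.
  have : 2 * AF * noise_level J.+1 w <= error_const * noise_level J.+1 w.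
    apply: ler_wpM2r => //; rewrite -subr_ge0.
    have -> : error_const - 2 * AF =
      gain_const * Num.sqrt cd + lyapunov_weight * trace_const by rewrite /error_const; ring.
    apply: addr_ge0; first exact: mulr_ge0 G0 (sqrtr_ge0 _).
    exact: mulr_ge0 Kz0 trace_const_ge0.
  by lra.
rewrite addnS /=.
have h1 := mean_error_step w (uB (J + i).+1 (leqW (leq_addr _ _))).
have h2 := noise_level_ge (J + i).+2 w.
have h3 : gain_const * Num.sqrt cd * delta <=
    gain_const * Num.sqrt cd * noise_level (J + i).+2 w.
  by apply: ler_wpM2l => //; rewrite mulr_ge0 ?sqrtr_ge0.
have h4 : lyapunov_weight * (trace_const * (delta + eps)) <=
    lyapunov_weight * trace_const * noise_level (J + i).+2 w.
  rewrite mulrA; apply: ler_wpM2l; first by rewrite mulr_ge0 ?trace_const_ge0.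
  exact: noise_level_lb.
have V0 : 0 <= Vnorm (m (J + i).+1 w - u (J + i).+1) by exact: sqrtr_ge0.
have h5 : rho * Vnorm (m (J + i).+1 w - u (J + i).+1) <=
    rho' * Vnorm (m (J + i).+1 w - u (J + i).+1).
  by apply: ler_wpM2r => //; exact: ltW rate'_gt.
(* The balance for which [lyapunov_weight] was chosen: the trace terms contract at rate [rho']
   exactly. *)
have h6 : gain_const * (rho * trace_root (J + i)) +
    lyapunov_weight * (rho * trace_root (J + i)) =
    rho' * (lyapunov_weight * trace_root (J + i)).
  have ne : rho' - rho != 0 by rewrite subr_eq0 gt_eqF// rate'_gt.
  have -> : gain_const * (rho * trace_root (J + i)) =
    (rho' - rho) * lyapunov_weight * trace_root (J + i).
    by rewrite /lyapunov_weight mulrC [X in _ = X * _]mulrC divfK//; ring.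
  ring.
have h7 := ler_wpM2l (proj1 (andP rate'01)) IH.
have hA : error_const * noise_level (J + i).+2 w =
  gain_const * Num.sqrt cd * noise_level (J + i).+2 w + 2 * AF * noise_level (J + i).+2 w +
  lyapunov_weight * trace_const * noise_level (J + i).+2 w.
  by rewrite /error_const; ring.
have h8 : lyapunov_weight * (rho * trace_root (J + i) + trace_const * (delta + eps)) =
  lyapunov_weight * (rho * trace_root (J + i)) + lyapunov_weight * (trace_const * (delta + eps)).
  by ring.
have h9 : gain_const * (rho * trace_root (J + i) + Num.sqrt cd * delta) =
  gain_const * (rho * trace_root (J + i)) + gain_const * Num.sqrt cd * delta by ring.
rewrite h8; rewrite h9 in h1.
have h10 : rho' * (Vnorm (m (J + i).+1 w - u (J + i).+1) +
    lyapunov_weight * trace_root (J + i)) =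
  rho' * Vnorm (m (J + i).+1 w - u (J + i).+1) +
    rho' * (lyapunov_weight * trace_root (J + i)) by ring.
rewrite h10 in h7.
apply: (@le_trans _ _ (rho' * Vnorm (m (J + i).+1 w - u (J + i).+1) +
  rho' * (lyapunov_weight * trace_root (J + i)) + error_const * noise_level (J + i).+2 w)).
  rewrite hA -h6.
  move: (le_trans h1 (lerD (lerD h5 (lexx _)) h2)) h3 h4.
  move: (Vnorm _) => v1; move: (rho' * _) (gain_const * (rho * _)) => v2 v3.
  by lra.
by rewrite [(J + i.+1)%N]addnS; exact: lerD h7 (lexx _).
Qed.

End FilterError.

(** * Comparison of the two filters through the signal *)

Unset Implicit Arguments.

Theorem theorem4p2 (R : realType) (H : completeNormedModType R)
  (ip : H -> H -> R) (k : nat) (Hop : H -> 'cV[R]_k) (Hs : 'cV[R]_k -> H)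
  (Rn : 'M[R]_k) (Psi : H -> H) (r beta L alpha kappa Ls : R)
  (PB : H -> H) (u0 m0 : H) (C0 : H -> H)
  (d : measure_display) (Omega : measurableType d) (Pr : probability Omega R)
  (eta : nat -> Omega -> 'cV[R]_k) :
  hilbert_ip ip ->
  obs_operator ip Hop Hs ->
  assumptionA Hop Hs Psi r beta L alpha ->
  is_Vprojection Hop Hs r beta PB ->
  noise_seq Pr eta Rn ->
  exists a0 : R, forall a : R, 0 < a -> a0 < a ->
  exists C3 : R,
  forall (eps delta : R) (Psis : H -> H)
         (m ms : nat -> Omega -> H) (C Cs : nat -> Omega -> H -> H),
  0 < eps ->
  assumptionB Hop Hs Psi Psis r beta kappa Ls delta ->
  let y := fun (j : nat) (w : Omega) => Hop (iter j Psi u0) + eps *: eta j w in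
  GPF ip Hop Hs Psi PB Rn eps a m0 C0 y m C ->
  GPF ip Hop Hs Psis PB Rn eps a m0 C0 y ms Cs ->
  (limn_esup (fun j => \int[Pr]_w (`|m j w - ms j w|)%:E)
     <= (C3 * (eps + delta))%:E)%E.
Proof.
move=> ipH obsH [r0 beta0 L0 alpha01 [absorb Psi_ball Psi_lip Psi_contr]] PBH noiseH.
have {}alpha01 : 0 < alpha < 1 by apply/andP.
have [e eH] := ker_frame_exists ipH obsH.
have [KR KR0 RK] := obs_norm_mulmx ipH obsH Rn.
have Rn_sym := noise_cov_sym noiseH.
have Rn_ge0 := noise_cov_ge0 noiseH.
have trR0 := noise_trace_ge0 noiseH.
exists 0 => a a0 _.
pose D := error_const beta r alpha kappa a KR Rn.
pose q := (1 + Num.sqrt (rate2 alpha)) / 2.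
have q01 : 0 <= q < 1 := rate'01 alpha01.
have q1 : 0 < 1 - q by rewrite subr_gt0; have /andP[] := q01.
(* The 2 comes from the triangle inequality through the signal, [1 + \tr Rn] from the mean noise
   level, and [1 - q] from the geometric sum. *)
exists (2 * (D * (1 + \tr Rn) / (1 - q))).
move=> eps delta Psis m ms C Cs eps0 [kappa0 Ls0 delta0 [Bkappa Bdelta Blip]] y GPFm GPFs.
have D0 : 0 <= D by apply: error_const_ge0.
have [J uB] := absorb u0.
have P0 : Pproj Hop Hs 0 = 0 by rewrite /Pproj (Hop0 obsH) (Hs0 ipH obsH).
have bound (F : H -> H) (LF : R) := @filter_error_bound R H ip k Hop Hs ipH obsH e eH
  beta r alpha kappa a KR Rn Psi PB u0 m0 C0 r0 kappa0 a0 beta0 alpha01 PBH Rn_sym Rn_ge0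
  trR0 KR0 RK Psi_ball Psi_contr eps delta LF F eps0 delta0.
have bm := bound Psi L (ltW L0) _ Psi_lip _ Omega eta m C GPFm J uB.
have bs := bound Psis Ls (ltW Ls0) _ Blip _ Omega eta ms Cs GPFs J uB.
move: bm bs; set K := (_ + lyapunov_weight _ _ _ _ * _).
pose g (i : nat) w := D * noise_level eps delta eta (J + i).+1 w.
rewrite -/D -/q -/g => bm bs.
have {}bm i w : Vnorm Hop Hs beta (m (J + i).+1 w - iter (J + i).+1 Psi u0) <=
    affine_rec q K g i w.
  (* For [F = Psi] the model error is zero, so the surrogate's [delta] bounds it too and both
     filters share one majorant. *)
  apply: bm => x xr; last by rewrite subrr P0 subrr normr0 ltW.
  by apply: (le_trans (Psi_ball _ xr)); rewrite lerDl ltW.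
have {}bs i w : Vnorm Hop Hs beta (ms (J + i).+1 w - iter (J + i).+1 Psi u0) <=
    affine_rec q K g i w.
  apply: bs => x xr; last exact: Bdelta.
  rewrite -[Psis x](subrK (Psi x)) addrC; apply: (le_trans (ler_normD _ _)).
  by apply: lerD; [exact: Psi_ball|exact: Bkappa].
pose G := D * (delta + eps * (1 + \tr Rn)).
have G0 : 0 <= G.
  by rewrite mulr_ge0// addr_ge0 ?(ltW delta0)// mulr_ge0 ?(ltW eps0)// addr_ge0.
have gE i w : g i w = D * (delta + eps) + D * eps * (\sum_(l < k) eta (J + i).+1 w l 0 ^+ 2).
  by rewrite /g /noise_level; ring.
have iN i := noise_sqr_integrable noiseH (J + i).+1.
have iDN i : Pr.-integrable setT
    (EFin \o fun w => D * eps * (\sum_(l < k) eta (J + i).+1 w l 0 ^+ 2)).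
  by have := integrableZl measurableT (D * eps) (iN i).
have ic := integrable_cst_prob Pr (D * (delta + eps)).
have ig i : Pr.-integrable setT (EFin \o g i).
  have -> : g i = fun w => D * (delta + eps) + D * eps * (\sum_(l < k) eta (J + i).+1 w l 0 ^+ 2).
    by apply/funext => w; rewrite gE.
  by have := integrableD measurableT ic (iDN i).
have Eg i : \int[Pr]_w g i w = G.
  under eq_Rintegral do rewrite gE.
  rewrite (RintegralD measurableT ic (iDN i)) Rintegral_cst_prob.
  rewrite (RintegralZl _ measurableT (iN i)) (noise_sqr_mean noiseH) /G; ring.
have rec i := affine_rec_mean K q01 ig G0 Eg i.
have q1' : 0 <= (1 - q)^-1 by rewrite invr_ge0 ltW.
apply: (@le_trans _ _ (2 * (G / (1 - q)))%:E); last first.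
  rewrite lee_fin -[leRHS]mulrA ler_pM2l// [leRHS]mulrAC; apply: ler_wpM2r => //.
  rewrite -mulrA; apply: ler_wpM2l => //.
  rewrite -subr_ge0.
  have -> : (1 + \tr Rn) * (eps + delta) - (delta + eps * (1 + \tr Rn)) = \tr Rn * delta.
    by ring.
  exact: mulr_ge0 trR0 (ltW delta0).
(* The indices up to [J], before the signal is known to stay in the ball and one analysis has
   followed, do not affect the upper limit. *)
apply: (@limn_esup_geometric_le _ _ J.+1 q (2 * K) _ q01) => i.
rewrite addSn.
have [iU EU] := rec i.
have iUU : Pr.-integrable setT (EFin \o fun w => 2 * affine_rec q K g i w).
  by have := integrableZl measurableT 2 iU.
apply: (@le_trans _ _ (\int[Pr]_w (2 * affine_rec q K g i w)%:E)%E).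
  apply: le_integral_ge0 => w; rewrite lee_fin//.
  have -> : m (J + i).+1 w - ms (J + i).+1 w =
    (m (J + i).+1 w - iter (J + i).+1 Psi u0) - (ms (J + i).+1 w - iter (J + i).+1 Psi u0).
    by rewrite opprB addrA subrK.
  apply: (le_trans (ler_normB _ _)); rewrite mulr_natl mulr2n.
  have VN x : `|x| <= Vnorm Hop Hs beta x.
    rewrite -ler_sqr ?nnegrE ?sqrtr_ge0// sqr_sqrtr ?V2_ge0//.
    exact: sqr_norm_le_V2.
  by apply: lerD; apply: (le_trans (VN _)).
rewrite (EFin_Rintegral iUU) lee_fin (RintegralZl _ measurableT iU).
have -> : q ^+ i * (2 * K) + 2 * (G / (1 - q)) = 2 * (q ^+ i * K + G / (1 - q)) by ring.
exact: ler_wpM2l.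
Qed.
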